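(* Fix $1<p\le\infty$. If $U$ is any Banach space with $\mathsf N_p$, then there exists a Banach space $X$ with $\mathsf A_p$ such that $X$ is not isomorphic to any subspace of any quotient of $U$. More precisely, if $q$ is the conjugate exponent of $p$, then there exists $\theta\in(0,1)$ such that $T^*_{q,\theta}$ is not isomorphic to any subspace of any quotient of $U$.
   Context: Banach spaces are over $\mathbb K\in\{\mathbb R,\mathbb C\}$ and infinite dimensional unless otherwise specified; subspaces are closed; $B_X$ is the closed unit ball of $X$. Games. For $1<p\le\infty$, a Banach space $X$, $n\in\mathbb N$, $c>0$: in the $A(c,p,n)$ game on $X$, for $i=1,\dots,n$ in turn, Player I chooses a weakly open neighborhood $U_i$ of $0$ and then Player II chooses $x_i\in U_i\cap B_X$. Player I wins if $\|\sum_{i=1}^n a_ix_i\|\le c$ for all $(a_i)_{i=1}^n$ in the closed unit ball of $\ell_p^n$. The $N(c,p,n)$ game is the same except that Player I wins iff $\|\sum_{i=1}^n x_i\|\le c\,n^{1/p}$ (with $n^{1/\infty}=1$). $X$ has $\mathsf A_p$ (resp. $\mathsf N_p$) if $\sup_n\inf\{c>0:$ Player I has a winning strategy in the $A(c,p,n)$ (resp. $N(c,p,n)$) game on $X\}<\infty$. The space $T_{q,\theta}$. For $\vartheta\in(0,1)$, the Tsirelson space $T_{\vartheta}$ is the completion of $c_{00}$ (finitely supported scalar sequences) under the norm implicitly defined by $$\|x\|_{T_\vartheta}=\max\Bigl\{\|x\|_{c_0},\ \vartheta\sup\Bigl\{\sum_{i=1}^n\|I_ix\|_{T_\vartheta}: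 n\in\mathbb N,\ n\le I_1<\dots<I_n\Bigr\}\Bigr\},$$ where the $I_i$ are intervals of $\mathbb N$, $I_ix$ is the restriction of $x$ to $I_i$ and $n\le I_1$ means $n\le\min I_1$. Its canonical basis $(e_j)$ is $1$-unconditional. For $1\le q<\infty$ and $\theta\in(0,1)$, $T_{q,\theta}$ is the $q$-convexification of $T_{\theta^q}$: the space of scalar sequences $x=(x_j)$ such that $\sum_j|x_j|^qe_j\in T_{\theta^q}$, with norm $\|x\|=\|\sum_j|x_j|^qe_j\|_{T_{\theta^q}}^{1/q}$. $T^*_{q,\theta}$ is its dual. *)

(* Defs.v *)
From HB Require Import structures.
From mathcomp Require Import all_boot all_order all_algebra.
From mathcomp Require Import all_classical all_reals all_analysis.
From mathcomp Require Import complex.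

Set Implicit Arguments.
Unset Strict Implicit.
Unset Printing Implicit Defensive.

Import Order.TTheory GRing.Theory Num.Theory.
Import numFieldNormedType.Exports.

Local Open Scope classical_set_scope.
Local Open Scope ring_scope.

(* The scalar field is R or R[i].  In `normedModType K` the norm takes values in
   K itself; `re` and `ofR` pass between nonnegative elements of K and R. *)
Variant scalar_kind := RealScalars | ComplexScalars.

Definition scalars (R : realType) (k : scalar_kind) : numFieldType :=
  match k with RealScalars => R | ComplexScalars => R[i] end.

Definition ofR {R : realType} {k : scalar_kind} : R -> scalars R k :=
  match k with
  | RealScalars => fun x => x
  | ComplexScalars => fun x => real_complex R x
  end.

Definition re {R : realType} {k : scalar_kind} : scalars R k -> R :=
  match k with
  | RealScalars => fun z => z
  | ComplexScalars => fun z => complex.Re z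
  end.

Section scalars_theory.
Context {R : realType} {k : scalar_kind}.
Local Notation K := (scalars R k).
Implicit Types (a b : R) (z w : K).

Definition rabs z : R := re `|z|.

Lemma ofRK : cancel (@ofR R k) re.
Proof. by case: k. Qed.

Lemma ofR0 : ofR 0 = 0 :> K.
Proof. by case: k. Qed.

Lemma ofR1 : ofR 1 = 1 :> K.
Proof. by case: k. Qed.

Lemma ofRD a b : ofR (a + b) = ofR a + ofR b :> K.
Proof. by case: k => //; exact: rmorphD. Qed.

Lemma ofRM a b : ofR (a * b) = ofR a * ofR b :> K.
Proof. by case: k => //; exact: rmorphM. Qed.

Lemma ler_ofR a b : (ofR a <= ofR b :> K) = (a <= b).
Proof. by case: k => //=; rewrite lecR. Qed.

Lemma ltr_ofR a b : (ofR a < ofR b :> K) = (a < b).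
Proof. by case: k => //=; rewrite ltcR. Qed.

Lemma reK z : 0 <= z -> ofR (re z) = z.
Proof.
case: k z => //= -[x y]; rewrite lecE/= => /andP[/eqP-> _].
by [].
Qed.

Lemma ofR_rabs z : ofR (rabs z) = `|z|.
Proof. exact: reK. Qed.

Lemma rabs_ge0 z : 0 <= rabs z.
Proof. by rewrite -ler_ofR ofR_rabs ofR0. Qed.

Lemma ler_rabsD z w : rabs (z + w) <= rabs z + rabs w.
Proof. by rewrite -ler_ofR ofRD !ofR_rabs ler_normD. Qed.

Lemma rabsM z w : rabs (z * w) = rabs z * rabs w.
Proof. by rewrite -[RHS]ofRK ofRM !ofR_rabs -normrM. Qed.

Lemma rabs0 : rabs 0 = 0.
Proof. by rewrite /rabs normr0 -[0 in LHS]ofR0 ofRK. Qed.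

Lemma rabsN z : rabs (- z) = rabs z.
Proof. by rewrite /rabs normrN. Qed.

Lemma rabs_eq0 z : rabs z = 0 -> z = 0.
Proof. by move=> z0; apply/normr0_eq0; rewrite -ofR_rabs z0 ofR0. Qed.

Lemma rabs_ofR a : 0 <= a -> rabs (ofR a) = a.
Proof. by move=> a0; rewrite /rabs ger0_norm ?ofRK// -ofR0 ler_ofR. Qed.

End scalars_theory.

Lemma complex_cauchy_cvg (R : realType) (F : set_system (R[i])^o) :
  ProperFilter F -> cauchy F -> cvg F.
Proof.
move=> FF /cauchyP Fc.
have cRI (f : R[i] -> R) : (forall z w, f (z - w) = f z - f w) ->
    (forall z, (`|f z|%:C)%C <= `|z|) -> cvg (f @ F).
  move=> fB fn; apply: R_complete; apply/cauchyP => e e0.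
  have e0' : 0 < (e%:C)%C :> R[i] by rewrite ltcR.
  have [z Fz] := Fc _ e0'; exists (f z).
  have -> : (f @ F) (ball (f z) e) = F (f @^-1` ball (f z) e) by [].
  apply: filterS Fz => w; rewrite -!ball_normE /ball_ /= => h.
  by rewrite -fB -ltcR; exact: le_lt_trans (fn _) h.
have /cvg_ex[a /= Fa] : cvg ((@complex.Re R) @ F).
  apply: cRI => [[? ?] [? ?]//|[x y]].
  exact: normc_ge_Re.
have /cvg_ex[b /= Fb] : cvg ((@complex.Im R) @ F).
  apply: cRI => [[? ?] [? ?]//|[x y]].
  rewrite normc_def/= lecR -sqrtr_sqr ler_wsqrtr// lerDr sqr_ge0//.
apply/cvg_ex; exists (Complex a b).
apply/cvgrPdist_lt => /= -[e1 e2]; rewrite ltcE/= => /andP[/eqP-> e0].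
have split_norm (z : R[i]) : `|Complex a b - z| <=
    ((`|a - complex.Re z| + `|b - complex.Im z|)%:C)%C.
  case: z => x y /=.
  have -> : Complex a b - Complex x y = Complex (a - x) 0 + Complex 0 (b - y).
    by apply/eqP; rewrite eq_complex /= addr0 add0r !eqxx.
  apply: le_trans (ler_normD _ _) _.
  by rewrite !normc_def/= !expr0n/= addr0 add0r !sqrtr_sqr -rmorphD/=.
move/cvgrPdist_lt : Fa => /(_ (e1 / 2)) Fa.
move/cvgrPdist_lt : Fb => /(_ (e1 / 2)) Fb.
near=> z.
apply: le_lt_trans (split_norm z) _.
rewrite -[Complex _ _]/((e1%:C)%C) ltcR [ltRHS](splitr e1) ltrD//.
  by near: z; apply: Fa; rewrite divr_gt0.
by near: z; apply: Fb; rewrite divr_gt0.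
Unshelve. all: by end_near. Qed.

Lemma scalars_cauchy_cvg (R : realType) (k : scalar_kind)
    (F : set_system (scalars R k)^o) : ProperFilter F -> cauchy F -> cvg F.
Proof.
case: k F => [F FF|F FF]; first exact: R_complete.
exact: complex_cauchy_cvg.
Qed.

Definition rnorm {R : realType} {k : scalar_kind}
  {V : normedModType (scalars R k)} (x : V) : R := re `|x|.

Section rnorm_theory.
Context {R : realType} {k : scalar_kind} {V : normedModType (scalars R k)}.
Implicit Types x y : V.

Lemma ofR_rnorm x : ofR (rnorm x) = `|x|.
Proof. exact: reK. Qed.

Lemma rnorm_ge0 x : 0 <= rnorm x.
Proof. by rewrite -(@ler_ofR R k) ofR_rnorm ofR0. Qed.

Lemma rnormZ (a : scalars R k) x : rnorm (a *: x) = rabs a * rnorm x.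
Proof. by rewrite -[RHS](@ofRK R k) ofRM ofR_rabs ofR_rnorm -normrZ. Qed.

Lemma ler_rnormD x y : rnorm (x + y) <= rnorm x + rnorm y.
Proof. by rewrite -(@ler_ofR R k) ofRD !ofR_rnorm ler_normD. Qed.

Lemma rnorm0 : rnorm (0 : V) = 0.
Proof. by rewrite /rnorm normr0 -(@ofR0 R k) ofRK. Qed.

End rnorm_theory.

Section dual.
Context {R : realType} {k : scalar_kind} (V : normedModType (scalars R k)).
Local Notation K := (scalars R k).

Definition dual_pred : {pred (V -> K^o)} :=
  fun f => `[< linear f /\ continuous f >].

Lemma dual_submod_closed : submod_closed dual_pred.
Proof.
split.
  apply/asboolP; split; last exact: cst_continuous.
  by move=> a u v; rewrite scaler0 addr0.
move=> a f g /asboolP[fl fc] /asboolP[gl gc]; apply/asboolP; split.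
  move=> b u v; rewrite !fctE /= fl gl !scalerDr !scalerA (mulrC a b).
  by rewrite -!addrA; congr (_ + _); rewrite addrCA.
by move=> x; apply: cvgD; [apply: cvgZr; exact: fc|exact: gc].
Qed.

HB.instance Definition _ :=
  GRing.isSubmodClosed.Build K (V -> K^o) dual_pred dual_submod_closed.

Record dual := Dual { dual_val :> V -> K^o; _ : dual_val \in dual_pred }.

HB.instance Definition _ := [isSub for dual_val].
HB.instance Definition _ := [Choice of dual by <:].
HB.instance Definition _ := [SubChoice_isSubLmodule of dual by <:].

Implicit Types f g : dual.

Lemma dual_linear f : linear f.
Proof. by case: f => /= f /asboolP[]. Qed.

Lemma dual_continuous f : continuous f.
Proof. by case: f => /= f /asboolP[]. Qed.

HB.instance Definition _ f :=
  GRing.isLinear.Build K V K^o *:%R f (dual_linear f).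

Definition dual_norm f : R :=
  sup [set rabs (f x) | x in [set x : V | rnorm x <= 1]].

Lemma dualP f g : f =1 g -> f = g.
Proof. by move=> fg; apply/val_inj/funext. Qed.

Lemma dual_bounded f : exists2 M : R, 0 <= M &
  forall x, rabs (f x) <= M * rnorm x.
Proof.
have /linear_bounded_continuous/linear_boundedP[M0 [M0r fM]] :=
  @dual_continuous f.
pose M := `|M0| + 1.
have M0M : M0 < M.
  by rewrite /M (le_lt_trans (real_ler_norm M0r))// ltrDl.
have M_ge0 : 0 <= M by rewrite addr_ge0.
exists (re M); first by rewrite -(@ler_ofR R k) reK// ofR0.
move=> x; rewrite -(@ler_ofR R k) ofRM reK// ofR_rnorm ofR_rabs.
exact: fM.
Qed.

Let dual_set f := [set rabs (f x) | x in [set x : V | rnorm x <= 1]].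

Let has_sup_dual f : has_sup (dual_set f).
Proof.
split; first by exists (rabs (f 0)); exists 0 => //=; rewrite rnorm0.
have [M M0 fM] := dual_bounded f; exists M => _ [x /= x1 <-].
by rewrite (le_trans (fM x))// ler_piMr.
Qed.

Lemma dual_norm_ge0 f : 0 <= dual_norm f.
Proof.
apply: le_trans (rabs_ge0 (f 0)) _; apply: (sup_upper_bound (has_sup_dual f)).
by exists 0 => //=; rewrite rnorm0.
Qed.

Lemma rabs_dual_le f x : rabs (f x) <= dual_norm f * rnorm x.
Proof.
have [x0|x0] := eqVneq (rnorm x) 0.
  have -> : x = 0 by apply/normr0_eq0; rewrite -ofR_rnorm x0 ofR0.
  by rewrite linear0 rabs0 mulr_ge0 ?dual_norm_ge0 ?rnorm_ge0.
have xgt0 : 0 < rnorm x by rewrite lt_neqAle eq_sym x0 rnorm_ge0.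
rewrite -ler_pdivrMr//.
have -> : rabs (f x) / rnorm x = rabs (f (ofR (rnorm x)^-1 *: x)).
  by rewrite linearZ /= rabsM rabs_ofR ?invr_ge0 ?rnorm_ge0// mulrC.
apply: (sup_upper_bound (has_sup_dual f)); exists (ofR (rnorm x)^-1 *: x) => //=.
by rewrite rnormZ rabs_ofR ?invr_ge0 ?rnorm_ge0// mulVf.
Qed.

Lemma dual_norm_le f (M : R) : 0 <= M ->
  (forall x, rabs (f x) <= M * rnorm x) -> dual_norm f <= M.
Proof.
move=> M0 fM; apply: ge_sup; first by case: (has_sup_dual f).
by move=> _ [x /= x1 <-]; rewrite (le_trans (fM x))// ler_piMr.
Qed.

Let knorm f : K := ofR (dual_norm f).

Let knormD f g : knorm (f + g) <= knorm f + knorm g.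
Proof.
rewrite -ofRD ler_ofR; apply: dual_norm_le => [|x].
  by rewrite addr_ge0 ?dual_norm_ge0.
by rewrite (le_trans (ler_rabsD _ _))// mulrDl lerD ?rabs_dual_le.
Qed.

Let dual_normZ_le (a : K) f : dual_norm (a *: f) <= rabs a * dual_norm f.
Proof.
apply: dual_norm_le => [|x]; first by rewrite mulr_ge0 ?rabs_ge0 ?dual_norm_ge0.
by rewrite rabsM -mulrA ler_wpM2l ?rabs_ge0 ?rabs_dual_le.
Qed.

Let knormZ (a : K) f : knorm (a *: f) = `|a| * knorm f.
Proof.
rewrite -ofR_rabs -ofRM; congr ofR; apply/eqP; rewrite eq_le dual_normZ_le/=.
have [->|a0] := eqVneq a 0; first by rewrite rabs0 mul0r dual_norm_ge0.
rewrite -{1}[f](scalerK a0) (le_trans (ler_wpM2l _ (dual_normZ_le _ _)))//.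
  exact: rabs_ge0.
by rewrite mulrA -rabsM divff// /rabs normr1 -(@ofR1 R k) ofRK mul1r.
Qed.

Let knorm0_eq0 f : knorm f = 0 -> f = 0.
Proof.
rewrite -(@ofR0 R k) => /(can_inj (@ofRK R k)) f0.
apply/dualP => x; apply: rabs_eq0; apply/eqP.
by rewrite eq_le rabs_ge0 andbT (le_trans (rabs_dual_le _ _))// f0 mul0r.
Qed.

HB.instance Definition _ :=
  Lmodule_isNormed.Build K dual knormD knormZ knorm0_eq0.

Lemma rnorm_dual f : rnorm f = dual_norm f.
Proof. exact: ofRK. Qed.

Let dual_cauchy_cvg (F : set_system dual) : ProperFilter F -> cauchy F -> cvg F.
Proof.
move=> FF /cauchyP Fc.
have Fpt x : cvg ((fun f : dual => f x : K^o) @ F).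
  apply: scalars_cauchy_cvg; apply/cauchyP => e e0.
  have d0 : 0 < e / (`|x| + 1) by rewrite divr_gt0// ltr_wpDl.
  have [f Ff] := Fc _ d0; exists (f x).
  have -> : ((fun f : dual => f x : K^o) @ F) (ball (f x : K^o) e) =
    F ((fun f : dual => f x : K^o) @^-1` ball (f x : K^o) e) by [].
  apply: filterS Ff => g; rewrite -!ball_normE /ball_ /= => fg.
  have -> : f x - g x = (f - g) x by [].
  rewrite -ofR_rabs (le_lt_trans (_ : _ <= ofR (rnorm (f - g) * rnorm x)))//.
    by rewrite ler_ofR rnorm_dual rabs_dual_le.
  rewrite ofRM !ofR_rnorm; apply: le_lt_trans (_ : _ <= `|f - g| * (`|x| + 1)) _.
    by rewrite ler_wpM2l// lerDl.
  by rewrite -ltr_pdivlMr// ltr_wpDl.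
pose l x : K^o := lim ((fun f : dual => f x : K^o) @ F).
have lE x : (fun f : dual => f x : K^o) @ F --> l x by exact: Fpt.
have l_lin : linear l.
  move=> a u v; apply: cvg_lim => //=.
  under eq_fun do rewrite dual_linear.
  by apply: cvgD; [apply: cvgZr; exact: lE|exact: lE].
have near_bound (f : dual) (e : R) : F (ball f (ofR e)) ->
    forall x, rabs (f x - l x) <= e * rnorm x.
  move=> Ff x; apply/ler_addgt0Pr => d d0.
  have d0' : 0 < ofR d :> K by rewrite -(@ofR0 R k) ltr_ofR.
  have /cvgrPdist_lt /(_ _ d0') lx := lE x.
  near F => g.
  have fg : rabs (f x - g x) <= e * rnorm x.
    have -> : f x - g x = (f - g) x by [].
    apply: le_trans (rabs_dual_le _ _) _.
    rewrite ler_wpM2r ?rnorm_ge0// -rnorm_dual -(@ler_ofR R k) ofR_rnorm ltW//.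
    by near: g; rewrite near_simpl -ball_normE in Ff *.
  have gl : rabs (g x - l x) <= d.
    rewrite -rabsN opprB -(@ler_ofR R k) ofR_rabs ltW//.
    by near: g.
  have -> : f x - l x = (f x - g x) + (g x - l x) by rewrite addrA subrK.
  by rewrite (le_trans (ler_rabsD _ _))// lerD.
have ofR_gt0 (e : R) : 0 < e -> 0 < ofR e :> K.
  by move=> e0; rewrite -(@ofR0 R k) ltr_ofR.
have [f0 Ff0] := Fc _ (ofR_gt0 _ (@ltr01 R)).
have l_bnd x : rabs (l x) <= (dual_norm f0 + 1) * rnorm x.
  have -> : l x = f0 x - (f0 x - l x) by rewrite opprB addrC subrK.
  rewrite (le_trans (ler_rabsD _ _))// rabsN mulrDl lerD ?rabs_dual_le//.
  exact: near_bound.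
have l_cont : continuous l.
  pose m : {linear V -> K^o} :=
    HB.pack l (GRing.isLinear.Build K V K^o *:%R l l_lin).
  apply: (@bounded_linear_continuous _ _ _ m).
  apply/linear_boundedP; exists (ofR (dual_norm f0 + 1)); split.
    by rewrite ger0_real// -(@ofR0 R k) ler_ofR addr_ge0 ?dual_norm_ge0.
  move=> r mr x; rewrite (le_trans _ (ler_wpM2r _ (ltW mr)))//.
  rewrite -[`|x|]ofR_rnorm -ofRM; have := l_bnd x.
  by rewrite -(@ler_ofR R k) ofR_rabs.
have l_dual : l \in dual_pred by apply/asboolP.
apply/cvg_ex; exists (Dual l_dual).
apply/cvgrPdist_le => /= e e0.
have re0 : 0 < re e by rewrite -(@ltr_ofR R k) reK ?ltW// ofR0.
have [f Ff] := Fc _ (ofR_gt0 _ (divr_gt0 re0 (@ltr0Sn R 1))).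
near=> g.
suff : rnorm (Dual l_dual - g) <= re e.
  by rewrite -(@ler_ofR R k) ofR_rnorm reK; [|exact: ltW].
rewrite rnorm_dual.
apply: dual_norm_le; first exact: ltW.
move=> x; have -> : (Dual l_dual - g) x = (f - g) x - (f x - l x).
  rewrite -[LHS]/(l x - g x) -[(f - g) x]/(f x - g x).
  by rewrite opprB [RHS]addrC addrA subrK.
rewrite (le_trans (ler_rabsD _ _))// rabsN (splitr (re e)) mulrDl.
rewrite lerD ?near_bound// (le_trans (rabs_dual_le _ _))// ler_wpM2r ?rnorm_ge0//.
rewrite -rnorm_dual -(@ler_ofR R k) ofR_rnorm ltW//.
by near: g; rewrite near_simpl -ball_normE in Ff *.
Unshelve. all: by end_near. Qed.

HB.instance Definition _ :=
  Uniform_isComplete.Build dual dual_cauchy_cvg.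

End dual.

(* Initial topology for the evaluation map into the product of copies of K
   indexed by the dual, i.e. for all continuous linear functionals. *)
Definition weak_topology {R : realType} {k : scalar_kind}
    (V : normedModType (scalars R k)) : Type :=
  initial_topology
    ((fun x f => f x) : V -> {ptws dual V -> (scalars R k)^o}).

HB.instance Definition _ {R : realType} {k : scalar_kind}
    (V : normedModType (scalars R k)) :=
  Topological.copy (weak_topology V) (initial_topology
    ((fun x f => f x) : V -> {ptws dual V -> (scalars R k)^o})).

Record closed_subspace {R : realType} {k : scalar_kind}
    (V : normedModType (scalars R k)) := ClosedSubspace {
  subspace_set :> set V ;
  subspace0 : subspace_set 0 ;
  subspaceDZ : forall (a : scalars R k) (x y : V),
    subspace_set x -> subspace_set y -> subspace_set (a *: x + y) ;
  subspace_closed : closed subspace_set }.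

Section quotient_space.
Context {R : realType} {k : scalar_kind} {V : normedModType (scalars R k)}.
Variable Y : closed_subspace V.
Local Notation K := (scalars R k).

Definition subspace_pred : {pred V} := fun x => `[< subspace_set Y x >].

Lemma subspace_pred_submod_closed : submod_closed subspace_pred.
Proof.
split; first by apply/asboolP/subspace0.
by move=> a x y /asboolP Yx /asboolP Yy; apply/asboolP/subspaceDZ.
Qed.

HB.instance Definition _ :=
  GRing.isSubmodClosed.Build K V subspace_pred subspace_pred_submod_closed.

Definition quotient_space : Type := Quotient.quot subspace_pred.

HB.instance Definition _ := GRing.Zmodule.copy quotient_space
  (Quotient.quot subspace_pred).

Definition quotient_map (x : V) : quotient_space :=
  (\pi_(Quotient.quot subspace_pred) x)%qT.

Lemma quotient_map_surj q : exists x, quotient_map x = q.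
Proof. by exists (repr q); exact: reprK. Qed.

Lemma quotient_mapP x y : quotient_map x = quotient_map y <-> subspace_set Y (x - y).
Proof.
split=> [/eqP xy|Yxy].
  by apply/asboolP; have := Quotient.idealrBE subspace_pred x y; rewrite xy => h.
apply/eqP; have := Quotient.idealrBE subspace_pred x y => <-.
exact/asboolP.
Qed.

Lemma quotient_mapB x y :
  quotient_map (x - y) = quotient_map x - quotient_map y.
Proof. exact: (raddfB ((\pi_(Quotient.quot subspace_pred))%qT : {additive V -> _})). Qed.

Lemma quotient_mapD x y :
  quotient_map (x + y) = quotient_map x + quotient_map y.
Proof. exact: (raddfD ((\pi_(Quotient.quot subspace_pred))%qT : {additive V -> _})). Qed.

Definition quotient_scale (a : K) (q : quotient_space) : quotient_space :=
  quotient_map (a *: repr q).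

Lemma quotient_mapZ a x :
  quotient_map (a *: x) = quotient_scale a (quotient_map x).
Proof.
apply/quotient_mapP; rewrite -scalerBr -[_ *: _]addr0.
apply: subspaceDZ; last exact: subspace0.
by apply/quotient_mapP; rewrite [RHS]reprK.
Qed.

Let scaleA a b q :
  quotient_scale a (quotient_scale b q) = quotient_scale (a * b) q.
Proof.
by have [x <-] := quotient_map_surj q; rewrite -!quotient_mapZ scalerA.
Qed.

Let scale1 : left_id 1 quotient_scale.
Proof.
by move=> q; have [x <-] := quotient_map_surj q; rewrite -quotient_mapZ scale1r.
Qed.

Let scaleDr : right_distributive quotient_scale +%R.
Proof.
move=> a q r; have [x <-] := quotient_map_surj q.
have [y <-] := quotient_map_surj r.
by rewrite -quotient_mapD -!quotient_mapZ -quotient_mapD scalerDr.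
Qed.

Let scaleDl q : {morph quotient_scale^~ q : a b / a + b}.
Proof.
move=> a b; have [x <-] := quotient_map_surj q.
by rewrite -!quotient_mapZ -quotient_mapD scalerDl.
Qed.

HB.instance Definition _ := GRing.Zmodule_isLmodule.Build K quotient_space
  scaleA scale1 scaleDr scaleDl.

HB.instance Definition _ := GRing.isZmodMorphism.Build V quotient_space
  quotient_map quotient_mapB.
HB.instance Definition _ := GRing.isScalable.Build K V quotient_space *:%R
  quotient_map quotient_mapZ.

Definition quotient_norm (q : quotient_space) : R :=
  inf [set rnorm x | x in [set x | quotient_map x = q]].

Let has_inf_quot q : has_inf [set rnorm x | x in [set x | quotient_map x = q]].
Proof.
split; last by exists 0 => _ [x _ <-]; exact: rnorm_ge0.
by have [x xq] := quotient_map_surj q; exists (rnorm x), x.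
Qed.

Lemma quotient_norm_ge0 q : 0 <= quotient_norm q.
Proof.
apply: lb_le_inf; first by case: (has_inf_quot q).
by move=> _ [x _ <-]; exact: rnorm_ge0.
Qed.

Lemma quotient_norm_le x : quotient_norm (quotient_map x) <= rnorm x.
Proof.
by apply: ge_inf; [case: (has_inf_quot (quotient_map x))|exists x].
Qed.

Lemma quotient_norm_lt q (e : R) : 0 < e ->
  exists2 x, quotient_map x = q & rnorm x < quotient_norm q + e.
Proof.
move=> e0; have [_ [x xq <-] xe] := inf_adherent e0 (has_inf_quot q).
by exists x.
Qed.

Let knorm (q : quotient_space) : K := ofR (quotient_norm q).

Let knormD q r : knorm (q + r) <= knorm q + knorm r.
Proof.
rewrite -ofRD ler_ofR; apply/ler_addgt0Pr => e e0.
have e20 : 0 < e / 2 by rewrite divr_gt0.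
have [x xq xe] := quotient_norm_lt q e20.
have [y yr ye] := quotient_norm_lt r e20.
rewrite -xq -yr -quotient_mapD in xe ye *.
rewrite (le_trans (quotient_norm_le _))// (le_trans (ler_rnormD _ _))//.
by rewrite (splitr e) addrACA lerD// ltW.
Qed.

Let normZ_le a q : quotient_norm (a *: q) <= rabs a * quotient_norm q.
Proof.
apply/ler_addgt0Pr => e e0.
have d0 : 0 < e / (rabs a + 1) by rewrite divr_gt0// ltr_wpDl ?rabs_ge0.
have [x xq xe] := quotient_norm_lt q d0.
rewrite -{1}xq -[a *: _]quotient_mapZ (le_trans (quotient_norm_le _))//.
rewrite rnormZ (le_trans (ler_wpM2l (rabs_ge0 a) (ltW xe)))// mulrDr lerD2l.
rewrite mulrCA; apply: ler_piMr; first exact: ltW.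
by rewrite ler_pdivrMr ?mul1r ?lerDl// ltr_wpDl ?rabs_ge0.
Qed.

Let knormZ a q : knorm (a *: q) = `|a| * knorm q.
Proof.
rewrite -ofR_rabs -ofRM; congr ofR; apply/eqP; rewrite eq_le normZ_le/=.
have [->|a0] := eqVneq a 0; first by rewrite rabs0 mul0r quotient_norm_ge0.
rewrite -{1}[q](scalerK a0) (le_trans (ler_wpM2l _ (normZ_le _ _)))//.
  exact: rabs_ge0.
by rewrite mulrA -rabsM divff// /rabs normr1 -(@ofR1 R k) ofRK mul1r.
Qed.

Let knorm0_eq0 q : knorm q = 0 -> q = 0.
Proof.
rewrite -(@ofR0 R k) => /(can_inj (@ofRK R k)) q0.
have [x xq] := quotient_map_surj q.
have Y0 : quotient_map 0 = 0.
  by rewrite -[in LHS](subrr (0 : V)) quotient_mapB subrr.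
rewrite -xq -Y0; apply/quotient_mapP; rewrite subr0.
apply: subspace_closed => B /nbhs_ballP[e /= e0 xeB].
have re0 : 0 < re e by rewrite -(@ltr_ofR R k) reK ?ltW// ofR0.
have [y yq] := quotient_norm_lt q re0; rewrite q0 add0r => ye.
exists (x - y); split; first by apply/quotient_mapP; rewrite xq yq.
apply: xeB; rewrite -ball_normE /ball_/= opprB addrC subrK.
by move: ye; rewrite -(@ltr_ofR R k) ofR_rnorm reK//; exact: ltW.
Qed.

HB.instance Definition _ :=
  Lmodule_isNormed.Build K quotient_space knormD knormZ knorm0_eq0.

Lemma rnorm_quotient (q : quotient_space) : rnorm q = quotient_norm q.
Proof. exact: ofRK. Qed.

End quotient_space.

Section banach_notions.
Context {R : realType} {k : scalar_kind}.
Local Notation K := (scalars R k).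

Definition infinite_dimensional (V : normedModType K) : Prop :=
  ~ exists (n : nat) (e : 'I_n -> V),
      forall x, exists a : 'I_n -> K, x = \sum_(i < n) a i *: e i.

Definition isomorphic_to_subspace (X V : normedModType K)
    (Z : closed_subspace V) : Prop :=
  exists (T : {linear X -> V}) (S : V -> X),
    [/\ continuous T, range T = Z, cancel T S & {within Z, continuous S}].

Definition isomorphic_to_subspace_of_quotient (X V : normedModType K) : Prop :=
  exists (Y : closed_subspace V) (Z : closed_subspace (quotient_space Y)),
    isomorphic_to_subspace X Z.

(* Player I's strategy sends the list of Player II's previous moves to a weakly
   open neighborhood of 0; `winning` is the condition on the outcome
   (x_1, ..., x_n) under which Player I wins. *)
Definition wins_playerI (V : normedModType K) (n : nat)
    (winning : n.-tuple V -> Prop) : Prop :=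
  exists2 sigma : seq V -> set V,
    forall h, open_nbhs (0 : weak_topology V) (sigma h) &
    forall x : n.-tuple V,
      (forall i : 'I_n, sigma (take i x) (tnth x i) /\ rnorm (tnth x i) <= 1) ->
      winning x.

(* Only used for 1 < p <= +oo. *)
Definition lp_norm (p : \bar R) (n : nat) (a : 'I_n -> K) : R :=
  if p is r%:E then (\sum_(i < n) rabs (a i) `^ r) `^ r^-1
  else \big[Num.max/0]_(i < n) rabs (a i).

(* n ^ (1 / p), with value 1 at p = +oo. *)
Definition proot (p : \bar R) (n : nat) : R :=
  if p is r%:E then n%:R `^ r^-1 else 1.

Definition A_game (c : R) (p : \bar R) (n : nat) (V : normedModType K) : Prop :=
  wins_playerI (fun x : n.-tuple V => forall a : 'I_n -> K,
    lp_norm p a <= 1 -> rnorm (\sum_(i < n) a i *: tnth x i) <= c).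

Definition N_game (c : R) (p : \bar R) (n : nat) (V : normedModType K) : Prop :=
  wins_playerI (fun x : n.-tuple V =>
    rnorm (\sum_(i < n) tnth x i) <= c * proot p n).

Definition A_const (p : \bar R) (n : nat) (V : normedModType K) : \bar R :=
  ereal_inf [set c%:E | c in [set c : R | 0 < c /\ A_game c p n V]].

Definition N_const (p : \bar R) (n : nat) (V : normedModType K) : \bar R :=
  ereal_inf [set c%:E | c in [set c : R | 0 < c /\ N_game c p n V]].

Definition has_A (p : \bar R) (V : normedModType K) : Prop :=
  (ereal_sup [set A_const p n V | n in [set: nat]] < +oo)%E.

Definition has_N (p : \bar R) (V : normedModType K) : Prop :=
  (ereal_sup [set N_const p n V | n in [set: nat]] < +oo)%E.

End banach_notions.

(* Coordinate j : nat of a sequence x is its coefficient on e_(j+1), the basis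
   being indexed by {1, 2, ...}; the pair (a, b) stands for the interval of all j
   with a <= j < b, whose least basis index is thus a + 1. *)
Section tsirelson.
Context {R : realType} {k : scalar_kind}.
Local Notation K := (scalars R k).
Implicit Types (x y z : nat -> K^o) (I J : nat * nat) (s : seq (nat * nat)).
Local Open Scope ereal_scope.

Definition c0_norm x : \bar R := ereal_sup (range (fun j => (rabs (x j))%:E)).

Definition restr_itv I x : nat -> K^o :=
  fun j => if (I.1 <= j < I.2)%N then x j else 0%R.

(* n <= I_1 < ... < I_n, with n = size s and nonempty I_i *)
Definition admissible s : bool :=
  all (fun I => (I.1 < I.2)%N && (size s <= I.1.+1)%N) s &&
  pairwise (fun I J => (I.2 <= J.1)%N) s.

(* Right-hand side of the implicit equation defining the norm. *)
Definition tsirelson_rhs (theta : R) (N : (nat -> K^o) -> \bar R) x : \bar R :=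
  maxe (c0_norm x)
    (theta%:E *
     ereal_sup [set \sum_(I <- s) N (restr_itv I x) | s in [set` admissible]]).

(* The norm is the supremum of the increasing iterates of the right-hand side from
   the c_0 norm.  It satisfies the implicit equation (tsirelson_normE), and it is
   the only finite solution on c_00 (tsirelson_norm_unique).  It is defined,
   with values in [0, +oo], on all scalar sequences. *)
Fixpoint tsirelson_iter (theta : R) (m : nat) : (nat -> K^o) -> \bar R :=
  if m is m'.+1 then tsirelson_rhs theta (tsirelson_iter theta m')
  else c0_norm.

Definition tsirelson_norm (theta : R) x : \bar R :=
  ereal_sup (range (fun m => tsirelson_iter theta m x)).

Definition finitely_supported x : Prop :=
  exists n : nat, forall j, (n <= j)%N -> x j = 0%R.

(* The completion of c_00, realized as a space of sequences: the closure of c_00 in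
   the sequences of finite norm, which form a Banach space for this norm. *)
Definition tsirelson_space (theta : R) : set (nat -> K^o) :=
  [set x | forall e : R, (0 < e)%R -> exists2 y, finitely_supported y &
           tsirelson_norm theta (x - y)%R < e%:E].

Lemma c0_norm_ge0 x : 0 <= c0_norm x.
Proof.
apply: (@le_trans _ _ (rabs (x 0%N))%:E); first by rewrite lee_fin rabs_ge0.
by apply: ereal_sup_ubound; exists 0%N.
Qed.

Lemma c0_norm_coord x j : (rabs (x j))%:E <= c0_norm x.
Proof. by apply: ereal_sup_ubound; exists j. Qed.

Section theta.
Variable theta : R.
Hypothesis theta_gt0 : (0 < theta)%R.
Local Notation iter := (tsirelson_iter theta).
Local Notation N := (tsirelson_norm theta).

Lemma tsirelson_rhs_le (F : (nat -> K^o) -> \bar R) x (B : \bar R) :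
  c0_norm x <= B ->
  (forall s, admissible s ->
     theta%:E * (\sum_(I <- s) F (restr_itv I x)) <= B) ->
  tsirelson_rhs theta F x <= B.
Proof.
move=> xB sB; rewrite ge_max xB /= muleC -lee_pdivlMr//.
apply: ge_ereal_sup => _ [s /= ads <-].
by rewrite lee_pdivlMr// muleC sB.
Qed.

Lemma tsirelson_rhs_ge (F : (nat -> K^o) -> \bar R) x s : admissible s ->
  theta%:E * (\sum_(I <- s) F (restr_itv I x)) <= tsirelson_rhs theta F x.
Proof.
move=> ads; rewrite le_max; apply/orP; right.
apply: lee_wpmul2l; first by rewrite lee_fin ltW.
by apply: ereal_sup_ubound; exists s.
Qed.

Lemma c0_norm_iter m x : c0_norm x <= iter m x.
Proof. by case: m => [//|m] /=; rewrite le_max lexx. Qed.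

Lemma tsirelson_iter_ge0 m x : 0 <= iter m x.
Proof. exact: le_trans (c0_norm_ge0 x) (c0_norm_iter m x). Qed.

Lemma tsirelson_iter_le_norm m x : iter m x <= N x.
Proof. by apply: ereal_sup_ubound; exists m. Qed.

Lemma tsirelson_norm_ge0 x : 0 <= N x.
Proof. exact: le_trans (tsirelson_iter_ge0 0 x) (tsirelson_iter_le_norm 0 x). Qed.

Lemma rabs_tsirelson_norm x j : (rabs (x j))%:E <= N x.
Proof.
exact: le_trans (c0_norm_coord x j) (tsirelson_iter_le_norm 0 x).
Qed.

Lemma tsirelson_iter_comb m x y z (a b : R) : (0 <= a)%R -> (0 <= b)%R ->
  (forall j, rabs (z j) <= a * rabs (x j) + b * rabs (y j))%R ->
  iter m z <= a%:E * iter m x + b%:E * iter m y.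
Proof.
move=> a0 b0; elim: m x y z => [|m IH] x y z zxy.
  apply: ge_ereal_sup => _ [j _ <-].
  apply: (@le_trans _ _ (a%:E * (rabs (x j))%:E + b%:E * (rabs (y j))%:E)).
    by rewrite -!EFinM -EFinD lee_fin.
  by rewrite leeD// lee_wpmul2l ?lee_fin//; exact: c0_norm_coord.
rewrite [iter m.+1]/=; apply: tsirelson_rhs_le => [|s ads].
  apply: (@le_trans _ _ (a%:E * c0_norm x + b%:E * c0_norm y)).
    apply: ge_ereal_sup => _ [j _ <-].
    apply: (@le_trans _ _ (a%:E * (rabs (x j))%:E + b%:E * (rabs (y j))%:E)).
      by rewrite -!EFinM -EFinD lee_fin.
    by rewrite leeD// lee_wpmul2l ?lee_fin//; exact: c0_norm_coord.
  by rewrite leeD// lee_wpmul2l ?lee_fin// /tsirelson_rhs le_max lexx.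
apply: (@le_trans _ _ (a%:E * (theta%:E * \sum_(I <- s) iter m (restr_itv I x)) +
                       b%:E * (theta%:E * \sum_(I <- s) iter m (restr_itv I y)))).
  rewrite !(muleCA _ theta%:E) -ge0_muleDr; last 2 first.
  - by rewrite mule_ge0 ?lee_fin// sume_ge0// => I _; exact: tsirelson_iter_ge0.
  - by rewrite mule_ge0 ?lee_fin// sume_ge0// => I _; exact: tsirelson_iter_ge0.
  apply: lee_wpmul2l; first by rewrite lee_fin ltW.
  rewrite !ge0_sume_distrr; last 2 first.
  - by move=> I _; exact: tsirelson_iter_ge0.
  - by move=> I _; exact: tsirelson_iter_ge0.
  rewrite -big_split /=; apply: lee_sum => I _; apply: IH => j.
  rewrite /restr_itv; case: ifPn => // _.
  by rewrite rabs0 !mulr0 addr0.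
by rewrite leeD// lee_wpmul2l ?lee_fin//; exact: tsirelson_rhs_ge.
Qed.

Lemma tsirelson_norm_comb x y z (a b : R) : (0 <= a)%R -> (0 <= b)%R ->
  (forall j, rabs (z j) <= a * rabs (x j) + b * rabs (y j))%R ->
  N z <= a%:E * N x + b%:E * N y.
Proof.
move=> a0 b0 zxy; apply: ge_ereal_sup => _ [m _ <-].
apply: le_trans (tsirelson_iter_comb m a0 b0 zxy) _.
by rewrite leeD// lee_wpmul2l ?lee_fin//; exact: tsirelson_iter_le_norm.
Qed.

Lemma tsirelson_norm_mono x z :
  (forall j, rabs (z j) <= rabs (x j))%R -> N z <= N x.
Proof.
move=> zx; have := @tsirelson_norm_comb x x z 1 0 ler01 (lexx _).
rewrite mul0e mul1e adde0; apply=> j.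
by rewrite mul0r mul1r addr0.
Qed.

Lemma admissible_sum_coord s x j : admissible s ->
  (\sum_(I <- s) rabs (restr_itv I x j) <= rabs (x j))%R.
Proof.
move=> /andP[_]; elim: s => [|I s IH] /=.
  by rewrite big_nil rabs_ge0.
rewrite big_cons => /andP[/allP Is ps]; rewrite {1}/restr_itv.
case: ifPn => [/andP[_ jI]|_]; last by rewrite rabs0 add0r IH.
rewrite big_seq big1 ?addr0// => J Js; rewrite /restr_itv ifF ?rabs0//.
by apply/negbTE; rewrite negb_and -ltnNge (leq_trans jI (Is _ Js)).
Qed.

Lemma tsirelson_iter_l1 m x n : (theta <= 1)%R ->
  (forall j, (n <= j)%N -> x j = 0%R) ->
  iter m x <= (\sum_(j < n) rabs (x j))%:E.
Proof.
move=> theta1; elim: m x => [|m IH] x xn.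
  apply: ge_ereal_sup => _ [j _ <-]; rewrite lee_fin.
  have [jn|nj] := ltnP j n.
    rewrite (bigD1 (Ordinal jn))//= lerDl sumr_ge0// => i _; exact: rabs_ge0.
  by rewrite xn// rabs0 sumr_ge0// => i _; exact: rabs_ge0.
rewrite [iter m.+1]/=; apply: tsirelson_rhs_le => [|s ads].
  apply: ge_ereal_sup => _ [j _ <-]; rewrite lee_fin.
  have [jn|nj] := ltnP j n.
    rewrite (bigD1 (Ordinal jn))//= lerDl sumr_ge0// => i _; exact: rabs_ge0.
  by rewrite xn// rabs0 sumr_ge0// => i _; exact: rabs_ge0.
have IHs : \sum_(I <- s) iter m (restr_itv I x) <=
    (\sum_(j < n) rabs (x j))%:E.
  apply: (@le_trans _ _
      (\sum_(I <- s) (\sum_(j < n) rabs (restr_itv I x j))%:E)).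
    apply: lee_sum => I _; apply: IH => j nj.
    by rewrite /restr_itv xn//; case: ifP.
  rewrite sumEFin lee_fin exchange_big /=; apply: ler_sum => j _.
  exact: admissible_sum_coord.
apply: le_trans IHs; rewrite gee_pMl//.
  by rewrite sume_ge0// => I _; exact: tsirelson_iter_ge0.
Qed.

Lemma tsirelson_norm_finite x : (theta <= 1)%R -> finitely_supported x ->
  N x < +oo.
Proof.
move=> theta1 [n xn]; apply: (@le_lt_trans _ _ (\sum_(j < n) rabs (x j))%:E).
  by apply: ge_ereal_sup => _ [m _ <-]; exact: tsirelson_iter_l1.
exact: ltry.
Qed.

Lemma tsirelson_rhs_mono (F G : (nat -> K^o) -> \bar R) x :
  (forall s, admissible s -> \sum_(I <- s) F (restr_itv I x) <=
                             \sum_(I <- s) G (restr_itv I x)) ->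
  tsirelson_rhs theta F x <= tsirelson_rhs theta G x.
Proof.
move=> FG; apply: tsirelson_rhs_le => [|s ads].
  by rewrite le_max lexx.
apply: le_trans (tsirelson_rhs_ge G x ads); apply: lee_wpmul2l (FG _ ads).
by rewrite lee_fin ltW.
Qed.

Lemma tsirelson_iter_nd x : {homo iter^~ x : m n / (m <= n)%N >-> m <= n}.
Proof.
apply/nondecreasing_seqP => m; elim: m x => [|m IH] x.
  exact: c0_norm_iter.
by apply: tsirelson_rhs_mono => s _; apply: lee_sum => I _; exact: IH.
Qed.

Lemma ge0_sum_sup (T : Type) (r : seq T) (f : T -> nat -> \bar R) :
  (forall i m, 0 <= f i m) ->
  (forall i, {homo f i : m n / (m <= n)%N >-> m <= n}) ->
  \sum_(i <- r) ereal_sup (range (f i)) =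
  ereal_sup (range (fun m => \sum_(i <- r) f i m)).
Proof.
move=> f0 fnd.
have /cvg_lim <- // : (fun m => \sum_(i <- r) f i m) @ \oo -->
    \sum_(i <- r) ereal_sup (range (f i)).
  apply: cvg_nnesum => i _; first by apply: nearW => m; exact: f0.
  exact: ereal_nondecreasing_cvgn.
apply: cvg_lim => //; apply: ereal_nondecreasing_cvgn => m n mn.
by apply: lee_sum => i _; exact: fnd.
Qed.

Lemma tsirelson_normE x : N x = tsirelson_rhs theta N x.
Proof.
apply/eqP; rewrite eq_le; apply/andP; split.
  apply: ge_ereal_sup => _ [[|m] _ <-]; first by rewrite /= le_max lexx.
  apply: tsirelson_rhs_mono => s _; apply: lee_sum => I _.
  exact: tsirelson_iter_le_norm.
apply: tsirelson_rhs_le => [|s ads]; first exact: (tsirelson_iter_le_norm 0).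
rewrite /tsirelson_norm ge0_sum_sup; last 2 first.
- by move=> I m; exact: tsirelson_iter_ge0.
- by move=> I; exact: tsirelson_iter_nd.
rewrite muleC -lee_pdivlMr//; apply: ge_ereal_sup => _ [m _ <-].
rewrite lee_pdivlMr// muleC.
apply: le_trans (tsirelson_iter_le_norm m.+1 x).
exact: tsirelson_rhs_ge.
Qed.

Lemma tsirelson_norm0 : N (fun=> 0%R) = 0.
Proof.
apply/eqP; rewrite eq_le tsirelson_norm_ge0 andbT.
have := @tsirelson_norm_comb (fun=> 0%R) (fun=> 0%R) (fun=> 0%R) 0 0 (lexx _) (lexx _).
by rewrite !mul0e adde0; apply=> j; rewrite rabs0 mulr0 addr0.
Qed.

Lemma tsirelson_norm_unique (M : (nat -> K^o) -> \bar R) : (theta < 1)%R ->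
  M (fun=> 0%R) = 0 ->
  (forall x, finitely_supported x -> 0 <= M x < +oo) ->
  (forall x, finitely_supported x -> M x = tsirelson_rhs theta M x) ->
  forall x, finitely_supported x -> M x = N x.
Proof.
move=> theta1 M0 Mfin ME.
have fsr I x : finitely_supported x -> finitely_supported (restr_itv I x).
  by move=> [n xn]; exists n => j /xn xj; rewrite /restr_itv xj; case: ifP.
have NM x : finitely_supported x -> N x <= M x.
  move=> fx; apply: ge_ereal_sup => _ [m _ <-]; elim: m x fx => [|m IH] x fx.
    by rewrite ME// le_max lexx.
  rewrite ME//; apply: tsirelson_rhs_mono => s _; apply: lee_sum => I _.
  exact/IH/fsr.
have MN d x a : (forall j, (j < a)%N || (a + d <= j)%N -> x j = 0%R) ->
    M x <= N x.
  elim/ltn_ind: d x a => d IH x a xad.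
  have fx : finitely_supported x.
    by exists (a + d)%N => j jd; rewrite xad// jd orbT.
  rewrite leNgt; apply/negP => NMx.
  have M_gt0 : 0 < M x by exact: le_lt_trans (tsirelson_norm_ge0 x) NMx.
  suff : M x <= maxe (N x) (theta%:E * M x).
    rewrite le_max leNgt NMx/=; apply/negP; rewrite -ltNge.
    have /andP[_ Mx] := Mfin _ fx.
    rewrite -[ltRHS]mul1e lte_pmul2r ?lte_fin//.
    by rewrite fin_numElt Mx (lt_trans _ M_gt0).
  rewrite {1}ME//; apply: tsirelson_rhs_le => [|s ads].
    by rewrite le_max; apply/orP; left; exact: (tsirelson_iter_le_norm 0).
  rewrite le_max; apply/orP.
  have [/hasP[I Is /andP[Ia Ib]]|/hasPn sNad] :=
      boolP (has (fun I => (I.1 <= a)%N && (a + d <= I.2)%N) s).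
    right; apply: lee_wpmul2l; first by rewrite lee_fin ltW.
    have xj j : (I.1 <= j < I.2)%N = false -> x j = 0%R.
      move=> Ij; apply: xad; move/negbT: Ij; rewrite negb_and -leqNgt -ltnNge.
      case/orP => [jI|Ij]; first by rewrite (leq_trans jI Ia).
      by rewrite (leq_trans Ib Ij) orbT.
    have IE : restr_itv I x = x.
      by apply/funext => j; rewrite /restr_itv; case: ifP => // /xj->.
    move: ads; rewrite /admissible => /andP[_].
    elim: s Is => // J s IHs; rewrite inE big_cons /=.
    case/predU1P => [<-|Is] /andP[/allP Js ps].
      rewrite IE big_seq big1 ?adde0// => J' J's.
      rewrite (_ : restr_itv J' x = fun=> 0%R)//.
      apply/funext => j; rewrite /restr_itv; case: ifP => // /andP[J'j _].
      apply: xj; apply/negbTE; rewrite negb_and -leqNgt orbC.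
      by rewrite (leq_trans (Js _ J's) J'j).
    rewrite (_ : restr_itv J x = fun=> 0%R) ?M0 ?add0e; first exact: IHs.
    apply/funext => j; rewrite /restr_itv; case: ifP => // /andP[_ jJ].
    apply: xj; apply/negbTE; rewrite negb_and -ltnNge.
    by rewrite (leq_trans jJ (Js _ Is)).
  left; apply: le_trans (_ : theta%:E * (\sum_(I <- s) N (restr_itv I x)) <= _).
    apply: lee_wpmul2l; first by rewrite lee_fin ltW.
    rewrite big_seq [leRHS]big_seq; apply: lee_sum => I Is.
    have := sNad _ Is; rewrite negb_and -!ltnNge => /orP[aI|Id].
      have [d0|d0] := posnP d.
        rewrite (_ : restr_itv I x = fun=> 0%R) ?M0 ?tsirelson_norm_ge0//.
        apply/funext => j; rewrite /restr_itv xad; first by case: ifP.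
        by rewrite d0 addn0; case: ltnP.
      apply: (IH d.-1 _ _ a.+1); first by rewrite prednK.
      move=> j; rewrite addSnnS prednK// /restr_itv ltnS => /orP[ja|dj].
        by rewrite ifF// [(_ <= j)%N]leqNgt (leq_ltn_trans ja aI).
      by rewrite xad ?dj ?orbT//; case: ifP.
    have [d0|d0] := posnP d.
      rewrite (_ : restr_itv I x = fun=> 0%R) ?M0 ?tsirelson_norm_ge0//.
      apply/funext => j; rewrite /restr_itv xad; first by case: ifP.
      by rewrite d0 addn0; case: ltnP.
    apply: (IH d.-1 _ _ a); first by rewrite prednK.
    move=> j; rewrite /restr_itv => /orP[ja|dj].
      by rewrite xad ?ja//; case: ifP.
    rewrite ifF//; apply/negbTE; rewrite negb_and -!ltnNge orbC.
    by rewrite (leq_trans Id)// -(prednK d0) addnS ltnS.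
  by rewrite [leRHS]tsirelson_normE; exact: tsirelson_rhs_ge.
move=> x fx; apply/eqP; rewrite eq_le NM// andbT.
by have [n xn] := fx; apply: (MN n x 0%N) => j; rewrite ltn0 add0n => /xn.
Qed.

End theta.
End tsirelson.

Lemma powR_convex_split (R : realType) (q l s t : R) : 1 <= q ->
  0 < l < 1 -> 0 <= s -> 0 <= t ->
  (s + t) `^ q <= l * (s / l) `^ q + (1 - l) * (t / (1 - l)) `^ q.
Proof.
move=> q1 /andP[l0 l1] s0 t0.
have m0 : 0 < 1 - l by rewrite subr_gt0.
have in_pos (u : R) : 0 <= u -> u \in (`[0, +oo[%classic : set R).
  by move=> u0; rewrite inE /= in_itv/= u0.
have := convex_powR q1 (Itv01 (ltW l0) (ltW l1))
  (in_pos _ (divr_ge0 s0 (ltW l0))) (in_pos _ (divr_ge0 t0 (ltW m0))).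
move=> /=; rewrite convRE [X in X `^ _ <= _ -> _]convRE /= /unstable.onem.
by rewrite mulrCA divff ?gt_eqF// mulr1 mulrCA divff ?gt_eqF// mulr1.
Qed.

Section tsirelson_convexification.
Context {R : realType} {k : scalar_kind}.
Local Notation K := (scalars R k).
Variables (q theta : R).
Hypothesis (q1 : 1 <= q) (theta01 : 0 < theta < 1).
Implicit Types x y z : nat -> K^o.

(* The coefficients of sum_j |x_j|^q e_j. *)
Definition power_seq x : nat -> K^o := fun j => ofR (rabs (x j) `^ q).

Local Notation N := (@tsirelson_norm R k (theta `^ q)).

Definition in_tsirelson_conv x : Prop :=
  tsirelson_space (theta `^ q) (power_seq x).

Definition tsirelson_conv_norm x : R := fine (N (power_seq x)) `^ q^-1.

Let q0 : 0 < q. Proof. exact: lt_le_trans q1. Qed.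
Let theta0 : 0 < theta. Proof. by case/andP: theta01. Qed.
Let t_gt0 : 0 < theta `^ q. Proof. exact: powR_gt0. Qed.
Let t_le1 : theta `^ q <= 1.
Proof.
case/andP: theta01 => _ theta1.
have -> : 1 = 1 `^ q :> R by rewrite powR1.
by apply: ge0_ler_powR; rewrite ?nnegrE ltW.
Qed.

Lemma rabs_power_seq x j : rabs (power_seq x j) = rabs (x j) `^ q.
Proof. by rewrite rabs_ofR// powR_ge0. Qed.

Let tail n x : nat -> K^o := fun j => if (n <= j)%N then x j else 0.

Let tail_small x : tsirelson_space (theta `^ q) x -> forall e : R, 0 < e ->
  exists n, forall m, (n <= m)%N -> (N (tail m x) < e%:E)%E.
Proof.
move=> Tx e e0; have [y [n yn] xy] := Tx _ e0; exists n => m nm.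
apply: le_lt_trans xy; apply: tsirelson_norm_mono => // j.
rewrite /tail; case: ifPn => [mj|_]; last by rewrite rabs0 rabs_ge0.
have -> : (x - y) j = x j - y j by [].
by rewrite yn ?subr0// (leq_trans nm).
Qed.

Lemma tsirelson_space_comb x y z (a b : R) : 0 <= a -> 0 <= b ->
  (forall j, rabs (z j) <= a * rabs (x j) + b * rabs (y j)) ->
  tsirelson_space (theta `^ q) x -> tsirelson_space (theta `^ q) y ->
  tsirelson_space (theta `^ q) z.
Proof.
move=> a0 b0 zxy Tx Ty e e0.
have da : 0 < e / 2 / (a + 1) by rewrite !divr_gt0// ltr_wpDl.
have db : 0 < e / 2 / (b + 1) by rewrite !divr_gt0// ltr_wpDl.
have [n nx] := tail_small Tx da; have [m my] := tail_small Ty db.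
pose p := maxn n m.
exists (fun j => if (p <= j)%N then 0 else z j).
  by exists p => j ->.
have -> : (z - (fun j => if (p <= j)%N then 0 else z j : K^o)) = tail p z.
  apply/funext => j; rewrite /tail.
  rewrite -[LHS]/(z j - (if (p <= j)%N then 0 else z j)).
  by case: ifP => _; rewrite ?subr0 ?subrr.
apply: (@le_lt_trans _ _ (a%:E * N (tail p x) + b%:E * N (tail p y))%E).
  apply: tsirelson_norm_comb => // j; rewrite /tail; case: ifP => // _.
  by rewrite rabs0 !mulr0 addr0.
have Nx := nx p (leq_maxl _ _); have Ny := my p (leq_maxr _ _).
have mulle (c : R) (u : \bar R) : 0 <= c -> (0 <= u)%E ->
    (u < (e / 2 / (c + 1))%:E)%E -> (c%:E * u < (e / 2)%:E)%E.
  move=> c0; case: u => [u||]//; rewrite !lee_fin !lte_fin => u0 ue.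
  have c1 : 0 < c + 1 by rewrite ltr_wpDl.
  apply: (@le_lt_trans _ _ ((c + 1) * u)); first by rewrite ler_wpM2r// lerDl.
  by rewrite mulrC -ltr_pdivlMr.
rewrite (splitr e) EFinD; apply: lteD; apply: mulle => //;
  exact: tsirelson_norm_ge0.
Qed.

Lemma tsirelson_space_finite x : tsirelson_space (theta `^ q) x -> (N x < +oo)%E.
Proof.
move=> Tx; have [y fy xy] := Tx 1 ltr01.
apply: (@le_lt_trans _ _ (1%:E * N (x - y)%R + 1%:E * N y)%E).
  apply: tsirelson_norm_comb => // j; rewrite !mul1r.
  have -> : x j = (x - y) j + y j by rewrite -[(x - y) j]/(x j - y j) subrK.
  exact: ler_rabsD.
rewrite !mul1e lte_add_pinfty//; first exact: lt_trans xy (ltry _).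
exact: tsirelson_norm_finite.
Qed.

Lemma rabs_power_seqD x y (l : R) j : 0 < l < 1 ->
  rabs (power_seq (x + y) j) <=
    l * (l^-1) `^ q * rabs (power_seq x j) +
    (1 - l) * ((1 - l)^-1) `^ q * rabs (power_seq y j).
Proof.
move=> l01; rewrite !rabs_power_seq.
have /andP[l0 l1] := l01; have m0 : 0 < 1 - l by rewrite subr_gt0.
rewrite (le_trans (_ : _ <= (rabs (x j) + rabs (y j)) `^ q))//.
  rewrite ge0_ler_powR ?nnegrE ?rabs_ge0 ?addr_ge0 ?rabs_ge0//.
  + exact: ltW.
  + exact: ler_rabsD.
rewrite (le_trans (powR_convex_split q1 l01 (rabs_ge0 _) (rabs_ge0 _)))//.
have li : 0 <= l^-1 by rewrite invr_ge0 ltW.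
have mi : 0 <= (1 - l)^-1 by rewrite invr_ge0 ltW.
by rewrite !powRM ?rabs_ge0// -!mulrA !(mulrC (_^-1 `^ q)).
Qed.

Lemma power_seqZ (a : K) x j :
  rabs (power_seq (a *: x) j) = rabs a `^ q * rabs (power_seq x j).
Proof.
by rewrite !rabs_power_seq -[(a *: x) j]/(a * x j) rabsM powRM ?rabs_ge0.
Qed.

Lemma in_tsirelson_conv0 : in_tsirelson_conv 0.
Proof.
move=> e e0; exists 0; first by exists 0%N.
rewrite subr0 (_ : power_seq _ = fun=> 0) ?tsirelson_norm0//.
by apply/funext => j; rewrite /power_seq rabs0 powR0 ?ofR0// gt_eqF.
Qed.

Lemma in_tsirelson_convDZ (a : K) x y :
  in_tsirelson_conv x -> in_tsirelson_conv y -> in_tsirelson_conv (a *: x + y).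
Proof.
have half01 : 0 < (2^-1 : R) < 1.
  by rewrite invr_gt0 ltr0n/= invf_lt1 ?ltr1n.
move=> Tx Ty.
pose c : R := 2^-1 * (2^-1)^-1 `^ q; pose d : R := (1 - 2^-1) * (1 - 2^-1)^-1 `^ q.
have m0 : 0 <= 1 - 2^-1 :> R.
  by case/andP : half01 => _ h; rewrite subr_ge0 ltW.
apply: (@tsirelson_space_comb (power_seq x) (power_seq y) _ (c * rabs a `^ q) d).
- by rewrite !mulr_ge0 ?powR_ge0 ?invr_ge0.
- by rewrite mulr_ge0 ?powR_ge0.
- move=> j; rewrite (le_trans (rabs_power_seqD _ _ _ half01))//.
  by rewrite power_seqZ mulrA.
- exact: Tx.
- exact: Ty.
Qed.

Lemma fine_tsirelson x : in_tsirelson_conv x ->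
  (fine (N (power_seq x)))%:E = N (power_seq x).
Proof.
move=> Tx; rewrite fineK// fin_numElt (tsirelson_space_finite Tx) andbT.
apply: (@lt_le_trans _ _ 0%E); [exact: ltNy0|exact: tsirelson_norm_ge0].
Qed.

Lemma fine_tsirelson_ge0 x : 0 <= fine (N (power_seq x)).
Proof. exact/fine_ge0/tsirelson_norm_ge0. Qed.

Lemma tsirelson_conv_norm_ge0 x : 0 <= tsirelson_conv_norm x.
Proof. exact: powR_ge0. Qed.

Lemma tsirelson_conv_normK x :
  tsirelson_conv_norm x `^ q = fine (N (power_seq x)).
Proof.
by rewrite -powRrM mulVf ?gt_eqF// powRr1// fine_tsirelson_ge0.
Qed.

Lemma tsirelson_conv_norm_le x (c : R) : 0 <= c ->
  (N (power_seq x) <= (c `^ q)%:E)%E -> tsirelson_conv_norm x <= c.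
Proof.
move=> c0 xc; have -> : c = (c `^ q) `^ q^-1.
  by rewrite -powRrM mulfV ?gt_eqF// powRr1.
apply: ge0_ler_powR; rewrite ?nnegrE ?invr_ge0 ?powR_ge0 ?fine_tsirelson_ge0//.
  exact: ltW.
rewrite -lee_fin fineK// fin_numElt (le_lt_trans xc) ?ltry// andbT.
apply: (@lt_le_trans _ _ 0%E); [exact: ltNy0|exact: tsirelson_norm_ge0].
Qed.

Lemma tsirelson_conv_norm_eq0 x : in_tsirelson_conv x ->
  tsirelson_conv_norm x = 0 -> x = 0.
Proof.
move=> Tx x0; apply/funext => j; apply: rabs_eq0.
have := rabs_tsirelson_norm (theta `^ q) (power_seq x) j.
rewrite -fine_tsirelson// -tsirelson_conv_normK x0 powR0 ?gt_eqF//.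
rewrite lee_fin rabs_power_seq => xj.
have : rabs (x j) `^ q = 0 by apply/eqP; rewrite eq_le xj powR_ge0.
by move/powR_eq0_eq0.
Qed.

Lemma tsirelson_conv_normD x y : in_tsirelson_conv x -> in_tsirelson_conv y ->
  tsirelson_conv_norm (x + y) <= tsirelson_conv_norm x + tsirelson_conv_norm y.
Proof.
move=> Tx Ty; move EA : (tsirelson_conv_norm x) => A.
move EB : (tsirelson_conv_norm y) => B.
have [A0|An0] := eqVneq A 0.
  by rewrite A0 in EA *; rewrite (tsirelson_conv_norm_eq0 Tx EA) !add0r EB.
have [B0|Bn0] := eqVneq B 0.
  by rewrite B0 in EB *; rewrite (tsirelson_conv_norm_eq0 Ty EB) !addr0 EA.
have A0 : 0 < A by rewrite lt_neqAle eq_sym An0 -EA tsirelson_conv_norm_ge0.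
have B0 : 0 < B by rewrite lt_neqAle eq_sym Bn0 -EB tsirelson_conv_norm_ge0.
have AB0 : 0 < A + B by rewrite addr_gt0.
pose l := A / (A + B).
have lE : 1 - l = B / (A + B).
  by apply/eqP; rewrite subr_eq /l -mulrDl [B + A]addrC divff ?eqxx// gt_eqF.
have l01 : 0 < l < 1 by rewrite divr_gt0//= ltr_pdivrMr// mul1r ltrDl.
apply: tsirelson_conv_norm_le; first exact: ltW.
have c0 : 0 <= l * l^-1 `^ q by rewrite mulr_ge0 ?powR_ge0// divr_ge0// ltW.
have d0 : 0 <= (1 - l) * (1 - l)^-1 `^ q.
  by rewrite mulr_ge0 ?powR_ge0// lE divr_ge0// ltW.
apply: le_trans (tsirelson_norm_comb t_gt0 c0 d0
  (fun j => rabs_power_seqD x y j l01)) _.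
rewrite -(fine_tsirelson Tx) -(fine_tsirelson Ty) -!tsirelson_conv_normK.
rewrite EA EB -!EFinM -EFinD lee_fin.
have div_powR (u : R) : 0 < u ->
    (u / (A + B)) * (u / (A + B))^-1 `^ q * u `^ q =
    (u / (A + B)) * (A + B) `^ q.
  move=> u0; have v0 : 0 <= (u / (A + B))^-1 by rewrite invr_ge0 divr_ge0// ltW.
  rewrite -mulrA -powRM//; last exact: ltW.
  by rewrite invf_div divfK// gt_eqF.
by rewrite lE !div_powR// -mulrDl -mulrDl divff ?mul1r// gt_eqF.
Qed.

Lemma tsirelson_conv_normZ_le (a : K) x : in_tsirelson_conv x ->
  tsirelson_conv_norm (a *: x) <= rabs a * tsirelson_conv_norm x.
Proof.
move=> Tx; apply: tsirelson_conv_norm_le.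
  by rewrite mulr_ge0 ?rabs_ge0 ?tsirelson_conv_norm_ge0.
rewrite powRM ?rabs_ge0 ?tsirelson_conv_norm_ge0// tsirelson_conv_normK.
rewrite EFinM fine_tsirelson// -[leRHS]adde0 -(mul0e (N (power_seq x))).
apply: tsirelson_norm_comb; rewrite ?powR_ge0// => j.
by rewrite power_seqZ mul0r addr0.
Qed.

End tsirelson_convexification.

Section tsirelson_conv_space.
Context {R : realType} (k : scalar_kind).
Local Notation K := (scalars R k).
Variables (q theta : R).

Definition tsirelson_conv_pred of 1 <= q & 0 < theta < 1 :
  {pred (nat -> K^o)} := fun x => `[< in_tsirelson_conv q theta x >].

Lemma tsirelson_conv_submod_closed (q1 : 1 <= q) (theta01 : 0 < theta < 1) :
  submod_closed (tsirelson_conv_pred q1 theta01).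
Proof.
split; first exact/asboolP/in_tsirelson_conv0.
by move=> a x y /asboolP Tx /asboolP Ty; exact/asboolP/in_tsirelson_convDZ.
Qed.

HB.instance Definition _ (q1 : 1 <= q) (theta01 : 0 < theta < 1) :=
  GRing.isSubmodClosed.Build K (nat -> K^o) (tsirelson_conv_pred q1 theta01)
    (tsirelson_conv_submod_closed q1 theta01).

Record tsirelson_conv (q1 : 1 <= q) (theta01 : 0 < theta < 1) := TsirelsonConv {
  tsirelson_seq :> nat -> K^o ;
  _ : tsirelson_seq \in tsirelson_conv_pred q1 theta01 }.

Section instances.
Variables (q1 : 1 <= q) (theta01 : 0 < theta < 1).
Local Notation T := (tsirelson_conv q1 theta01).

HB.instance Definition _ := [isSub of T for @tsirelson_seq q1 theta01].
HB.instance Definition _ := [Choice of T by <:].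
HB.instance Definition _ := [SubChoice_isSubLmodule of T by <:].

Lemma tsirelson_seqP (x : T) : in_tsirelson_conv q theta x.
Proof. by have /asboolP := valP x. Qed.

Let knorm (x : T) : K := ofR (tsirelson_conv_norm q theta x).

Let knormD x y : knorm (x + y) <= knorm x + knorm y.
Proof.
by rewrite -ofRD ler_ofR tsirelson_conv_normD//; exact: tsirelson_seqP.
Qed.

Let normZ_le (a : K) (x : T) : tsirelson_conv_norm q theta (a *: x : T) <=
  rabs a * tsirelson_conv_norm q theta x.
Proof. exact: (tsirelson_conv_normZ_le q1 theta01 a (tsirelson_seqP x)). Qed.

Let knormZ (a : K) x : knorm (a *: x) = `|a| * knorm x.
Proof.
rewrite -ofR_rabs -ofRM; congr ofR; apply/eqP; rewrite eq_le normZ_le/=.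
have [->|a0] := eqVneq a 0.
  by rewrite rabs0 mul0r tsirelson_conv_norm_ge0.
rewrite -{1}[x](scalerK a0) (le_trans (ler_wpM2l _ (normZ_le _ _)))//.
  exact: rabs_ge0.
by rewrite mulrA -rabsM divff// /rabs normr1 -(@ofR1 R k) ofRK mul1r.
Qed.

Let knorm0_eq0 x : knorm x = 0 -> x = 0.
Proof.
rewrite -(@ofR0 R k) => /(can_inj (@ofRK R k)) x0.
apply/val_inj; exact: (tsirelson_conv_norm_eq0 q1 theta01 (tsirelson_seqP x) x0).
Qed.

HB.instance Definition _ := Lmodule_isNormed.Build K T knormD knormZ knorm0_eq0.

Lemma rnorm_tsirelson (x : T) : rnorm x = tsirelson_conv_norm q theta x.
Proof. exact: ofRK. Qed.

End instances.
End tsirelson_conv_space.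

Lemma fine_hoelder_conjugate_ge1 (R : realType) (p : \bar R) : (1 < p)%E ->
  1 <= fine (hoelder_conjugate p).
Proof.
move=> p1; have := hoelder_conj_ge1 (ltW p1).
case pE : (hoelder_conjugate p) => [r||]//=.
by move: p1; rewrite (hoelder_conjugate_eqy pE) ltxx.
Qed.

(* Main.v *)
Require Import Defs.
From HB Require Import structures.
From mathcomp Require Import all_boot all_order all_algebra.
From mathcomp Require Import all_classical all_reals all_analysis.
From mathcomp Require Import complex ring lra.

(** Write T for T_{q,theta} and t for theta^q; T' is the dual of T, and C is a
    constant with which Player I wins all the N-games on U.  The theorem follows
    from two estimates on repeated averages that grow at different speeds, and
    theta = 1/(4C) is what makes them incompatible.

    In U, the bound on N-games can be iterated.  Player II may answer a move of
    a game of length n with the normalised outcome of another game, whose length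
    is decided at that moment: by keeping the moves of that game in a smaller
    weak neighbourhood, its outcome becomes a legal move.  Unwinding i levels
    gives vectors of norm at most C^i which are sums of elementary moves with
    coefficients the products of the n^(-1/p) met along the levels.

    In T', the same combinations of coordinate functionals are much longer.
    They take a fixed value, 1 up to scaling, at the vector x of T whose
    coefficients are the products of the n^(-1/q), so that |x|^q is a repeated
    convex average of basis vectors.
    If the lengths n grow fast enough, each level of averaging multiplies the
    norm in T_t by at most 2t [spread_blocks]; hence x has norm at most
    (2 theta)^i, and the functional has norm at least (2 theta)^(-i) = 2^i C^i.
    The gap 2^i defeats every isomorphism constant.

    The moves are transported to U as follows.  Given F from T' to U/Y, lift the
    images of the coordinate functionals to a bounded sequence (v_j) of U.  The
    lifts have no reason to be weakly null, but by the pigeonhole principle every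
    weak neighbourhood of 0 contains differences v_i - v_j with i < j as large as
    desired [weak_close_pair].  These differences are the elementary moves, and
    the test vector is supported on the indices i only.  The induction over
    levels is [block_playS], the contradiction [not_bounded_below].

    That T' has A_p rests on every f in T' having small norm on tails
    [shrinking].  Knowing this, Player I waits until the functionals already
    played are negligible beyond N, and then asks the next one to be negligible
    before N.  The functionals played act on n successive intervals beginning
    after n, an admissible family, so Hoelder's inequality and the definition of
    the Tsirelson norm give the constant 1/theta + 1.  The functionals shrink on
    tails by the argument of Figiel and Johnson against copies of l_1: on
    y_0 + (y_1 + ... + y_n)/n, with blocks y_i that almost attain the norm of f on
    tails, f would be almost twice that norm, while this vector has norm at most
    1 + t + small for large n [tnorm_average]. *)

Set Implicit Arguments.
Unset Strict Implicit.
Unset Printing Implicit Defensive.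

Import Order.TTheory GRing.Theory Num.Theory.
Import numFieldNormedType.Exports.

Local Open Scope classical_set_scope.
Local Open Scope ring_scope.

(** * Weak neighbourhoods of the origin *)
Section weak_nbhs.
Context {R : realType} {k : scalar_kind} {V : normedModType (scalars R k)}.
Local Notation K := (scalars R k).

Lemma ltr_rabs (z : K) (e : R) : (`|z| < ofR e) = (rabs z < e).
Proof. by rewrite -ofR_rabs ltr_ofR. Qed.

Lemma ofR_gt0 (e : R) : (0 < ofR e :> K) = (0 < e).
Proof. by rewrite -(@ofR0 R k) ltr_ofR. Qed.

Lemma bounded_dual_pred (f : V -> K^o) (M : R) : linear f -> 0 <= M ->
  (forall x, rabs (f x) <= M * rnorm x) -> f \in @dual_pred R k V.
Proof.
move=> fl M0 fM; apply/asboolP; split=> //.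
pose m : {linear V -> K^o} :=
  HB.pack f (GRing.isLinear.Build K V K^o *:%R f fl).
apply: (@bounded_linear_continuous _ _ _ m).
apply/linear_boundedP; exists (ofR M); split.
  by rewrite ger0_real// -(@ofR0 R k) ler_ofR.
move=> r mr x; rewrite (le_trans _ (ler_wpM2r _ (ltW mr)))//.
by rewrite -[`|x|]ofR_rnorm -ofRM -[`|m x|]ofR_rabs ler_ofR fM.
Qed.

(** The filter generated by the sets on the right converges to 0 at every
    functional, hence weakly, so it contains [W]. *)
Lemma weak_nbhs_finite (W : set V) : open_nbhs (0 : Defs.weak_topology V) W ->
  exists (G : seq (dual V)) (e : R), 0 < e /\
    forall x : V, (forall g, g \in G -> rabs (g x) < e) -> W x.
Proof.
move=> [[D oD <-] D0].
pose B (G : seq (dual V)) (e : R) := [set x : V | forall g, g \in G -> rabs (g x) < e].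
pose F : set_system V := [set A | exists (G : seq (dual V)) (e : R), 0 < e /\ B G e `<=` A].
have FF : Filter F.
  constructor.
  - by exists [::], 1; split.
  - move=> P Q [G [e [e0 GP]]] [H [d [d0 HQ]]].
    exists (G ++ H), (Num.min e d); split; first by rewrite lt_min e0 d0.
    move=> x Bx; split; [apply: GP|apply: HQ] => g gG.
      by have := Bx g; rewrite mem_cat gG lt_min => /(_ isT)/andP[].
    by have := Bx g; rewrite mem_cat gG orbT lt_min => /(_ isT)/andP[].
  - by move=> P Q PQ [G [e [e0 GP]]]; exists G, e; split=> // x /GP/PQ.
pose ev : V -> {ptws dual V -> K^o} := fun x f => f x.
have : {ptws, ev @ F --> ev 0}.
  apply/pointwise_cvgP => g; rewrite /ev /= linear0; apply/cvgrPdist_lt => /= e e0.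
  have re0 : 0 < re e by rewrite -(@ltr_ofR R k) reK ?ltW// ofR0.
  exists [:: g], (re e); split=> // x /(_ g); rewrite inE eqxx => /(_ isT) gx /=.
  by rewrite sub0r normrN -(reK (ltW e0)) ltr_rabs.
move=> /(_ D) []; first by rewrite nbhsE; exists D.
by move=> G [e [e0 GD]]; exists G, e; split=> // x /GD.
Qed.

Lemma open_nbhs_finite (G : seq (dual V)) (e : R) : 0 < e ->
  open_nbhs (0 : Defs.weak_topology V) [set x : V | forall g, g \in G -> rabs (g x) < e].
Proof.
move=> e0; split; last by move=> g _ /=; rewrite linear0 rabs0.
have gc (g : dual V) : continuous (fun x : Defs.weak_topology V => (g : V -> K^o) x).
  move=> x; pose ev : Defs.weak_topology V -> {ptws dual V -> K^o} := fun x f => f x.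
  have evc : continuous ev by exact: initial_continuous.
  have /pointwise_cvgP : {ptws, ev @ nbhs x --> ev x} by exact: evc.
  exact.
elim: G => [|g G IH].
  by rewrite (_ : [set _ | _] = setT)//; [exact: openT|apply/seteqP; split].
rewrite (_ : [set _ | _] =
  ((fun x : Defs.weak_topology V => (g : V -> K^o) x) @^-1` [set z | `|z| < ofR e])
  `&` [set x | forall g, g \in G -> rabs (g x) < e]).
  apply: openI => //; apply: open_comp; first by move=> x _; exact: gc.
  rewrite (_ : [set _ | _] = ball (0 : K^o) (ofR e)).
    by apply: ball_open; rewrite ofR_gt0.
  by apply/seteqP; split=> z /=; rewrite -ball_normE /ball_/= sub0r normrN.
apply/seteqP; split=> x /=.
  move=> H; split; first by rewrite ltr_rabs H// inE eqxx.
  by move=> h hG; apply: H; rewrite inE hG orbT.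
by move=> [gx H] h; rewrite inE => /orP[/eqP->|/H//]; rewrite -ltr_rabs.
Qed.

End weak_nbhs.

Section eval.
Context {R : realType} {k : scalar_kind} {V : normedModType (scalars R k)}.
Local Notation K := (scalars R k).

Definition eval_at (x : V) (f : dual V) : K^o := f x.

Lemma eval_at_dual x : eval_at x \in @dual_pred R k (dual V).
Proof.
apply: (@bounded_dual_pred _ _ _ _ (rnorm x)) => [a f g||f].
- by [].
- exact: rnorm_ge0.
- by rewrite mulrC rnorm_dual rabs_dual_le.
Qed.

Definition eval_dual x : dual (dual V) := Dual (eval_at_dual x).
End eval.

(** * Weakly close terms in a bounded sequence *)
Section pigeonhole.
Context {R : realType}.

Definition infinite_nat (S : set nat) := forall N, exists2 j, (N <= j)%N & S j.

Lemma infinite_color (S : set nat) (c : nat -> nat) b : infinite_nat S ->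
  (forall j, S j -> (c j < b)%N) -> exists i, infinite_nat (S `&` [set j | c j = i]).
Proof.
elim: b S => [|b IH] S Sinf cb; first by have [j _ /cb] := Sinf 0%N.
have [|H] := pselect (infinite_nat (S `&` [set j | c j = b])); first by exists b.
have /existsNP[N HN] := H.
have [|j [Sj jN]|i Hi] := IH (S `&` [set j | (N <= j)%N]).
- move=> M; have [j] := Sinf (maxn M N); rewrite geq_max => /andP[Mj Nj] Sj.
  by exists j.
- have := cb j Sj; rewrite ltnS leq_eqVlt => /orP[/eqP cj|//].
  by exfalso; apply: HN; exists j.
- by exists i => M; have [j Mj [[Sj _] cj]] := Hi M; exists j.
Qed.

(** Each function of the list is discretised into finitely many cells of
    width [e], and infinitely many indices fall into the same cell. *)
Lemma infinite_close (H : seq (nat -> R)) (B e : R) (S : set nat) :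
  0 < e -> infinite_nat S -> (forall h, h \in H -> forall j, `|h j| <= B) ->
  exists2 S', infinite_nat S' & S' `<=` S /\
    forall h, h \in H -> forall i j, S' i -> S' j -> `|h i - h j| < e.
Proof.
move=> e0; elim: H S => [|h H IH] S Sinf HB; first by exists S => //; split.
have [|S' S'inf [S'S S'H]] := IH S Sinf; first by move=> g gH; apply: HB; rewrite inE gH orbT.
pose c j := Num.truncn ((h j + B) / e).
have hB j : 0 <= h j + B.
  have := HB h; rewrite inE eqxx => /(_ isT j); rewrite ler_norml => /andP[h1 _].
  by rewrite -lerBlDr sub0r.
have ce j : (c j)%:R * e <= h j + B < ((c j).+1)%:R * e.
  have /truncn_itv/andP[l r] : 0 <= (h j + B) / e by rewrite divr_ge0// ltW.
  by rewrite -ler_pdivlMr// l -ltr_pdivrMr.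
have [j Sj|i Si] := @infinite_color S' c (Num.truncn ((B + B) / e)).+1 S'inf.
  rewrite ltnS; apply: le_truncn; rewrite ler_pM2r ?invr_gt0// lerD2r.
  have := HB h; rewrite inE eqxx => /(_ isT j); exact/le_trans/ler_norm.
exists (S' `&` [set j | c j = i]) => //; split; first by move=> j [/S'S].
move=> g; rewrite inE => /orP[/eqP->|gH] i1 i2 [S1 c1] [S2 c2]; last exact: S'H.
have := ce i1; have := ce i2; rewrite c1 c2 => /andP[a1 a2] /andP[b1 b2].
rewrite ltr_norml; move: a1 a2 b1 b2; rewrite -natr1 mulrDl mul1r; lra.
Qed.
End pigeonhole.

Section weak_close.
Context {R : realType} {k : scalar_kind} {V : normedModType (scalars R k)}.
Local Notation K := (scalars R k).

(** Reduces the pigeonhole argument to real sequences, whatever the scalar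
    field. *)
Lemma scalar_coords : exists a b : K -> R,
  [/\ forall z w, a (z - w) = a z - a w, forall z w, b (z - w) = b z - b w &
      forall z, [/\ `|a z| <= rabs z, `|b z| <= rabs z & rabs z <= `|a z| + `|b z|]].
Proof.
case: k.
  exists id, (fun=> 0); split=> // [z w|z]; first by rewrite subr0.
  by split; rewrite ?normr0 ?addr0 ?rabs_ge0.
exists (@complex.Re R), (@complex.Im R); split=> [[? ?] [? ?]|[? ?] [? ?]|[x y]] //=.
rewrite /rabs /=.
split.
- by rewrite -sqrtr_sqr ler_wsqrtr// lerDl sqr_ge0.
- by rewrite -sqrtr_sqr ler_wsqrtr// lerDr sqr_ge0.
- rewrite -[leRHS]ger0_norm ?addr_ge0// -sqrtr_sqr ler_wsqrtr// sqrrD !real_normK ?num_real//.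
  by rewrite lerD2r lerDl mulrn_wge0// mulr_ge0.
Qed.

(** Replaces weak nullity: the sequence may be any bounded one, since the
    differences of its terms approach 0 weakly along suitable pairs. *)
Lemma weak_close_pair (v : nat -> V) (G : seq (dual V)) (e : R) N : 0 < e ->
  (forall j, rnorm (v j) <= 1) ->
  exists i j, [/\ (N <= i)%N, (i < j)%N & forall g, g \in G -> rabs (g (v i - v j)) < e].
Proof.
move=> e0 v1; have [a [b [aB bB ab]]] := scalar_coords.
pose H := [seq (fun j => a (g (v j))) | g : dual V <- G] ++
  [seq (fun j => b (g (v j))) | g : dual V <- G].
pose B := \sum_(g <- G) dual_norm g.
have gB (g : dual V) j : g \in G -> rabs (g (v j)) <= B.
  move=> gG; apply: le_trans (rabs_dual_le _ _) _.
  apply: (@le_trans _ _ (dual_norm g)); first by rewrite ler_piMr ?dual_norm_ge0.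
  by rewrite /B (big_rem g)//= lerDl sumr_ge0// => ? _; exact: dual_norm_ge0.
have e2 : 0 < e / 2 by rewrite divr_gt0.
have [||S Sinf [_ HS]] := @infinite_close R H B (e / 2) setT e2.
- by move=> M; exists M.
- move=> h; rewrite mem_cat => /orP[] /mapP[g gG ->] j.
    by case: (ab (g (v j))) => /le_trans h1 _ _; apply/h1/gB.
  by case: (ab (g (v j))) => _ /le_trans h1 _; apply/h1/gB.
have [i Ni Si] := Sinf N; have [j ij Sj] := Sinf i.+1; exists i, j; split=> // g gG.
have [_ _ /le_lt_trans->//] := ab (g (v i - v j)).
rewrite linearB aB bB (splitr e) ltrD//.
  by apply: (HS (fun j => a (g (v j)))) => //; rewrite mem_cat map_f.
by apply: (HS (fun j => b (g (v j)))) => //; rewrite mem_cat orbC map_f.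
Qed.
End weak_close.

(** * The Tsirelson norm on finitely supported sequences *)
Section tsirelson_real.
Context {R : realType} {k : scalar_kind} (t : R).
Hypothesis t01 : 0 < t < 1.
Local Notation K := (scalars R k).
Implicit Types (x y z : nat -> K^o) (s : seq (nat * nat)).

Let t0 : 0 < t. Proof. by case/andP: t01. Qed.
Let t1 : t <= 1. Proof. by case/andP: t01 => _ /ltW. Qed.

Definition tnorm x : R := fine (tsirelson_norm t x).

Lemma tnormE x : finitely_supported x -> (tnorm x)%:E = tsirelson_norm t x.
Proof.
move=> fx; rewrite fineK// fin_numElt (tsirelson_norm_finite t0 t1 fx) andbT.
by apply: (@lt_le_trans _ _ 0%E); [exact: ltNy0|exact: tsirelson_norm_ge0].
Qed.

Lemma finitely_supported_le x z : finitely_supported x ->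
  (forall j, rabs (z j) <= rabs (x j)) -> finitely_supported z.
Proof.
move=> [n xn] zx; exists n => j nj; apply: rabs_eq0; apply/eqP.
by rewrite eq_le rabs_ge0 andbT (le_trans (zx j))// xn// rabs0.
Qed.

Lemma finitely_supported_restr I x : finitely_supported x ->
  finitely_supported (restr_itv I x).
Proof.
move=> /finitely_supported_le; apply => j; rewrite /restr_itv.
by case: ifP; rewrite ?rabs0 ?rabs_ge0.
Qed.

Lemma tnorm_coord x j : finitely_supported x -> rabs (x j) <= tnorm x.
Proof. by move=> fx; rewrite -lee_fin tnormE//; exact: rabs_tsirelson_norm. Qed.

Lemma tnorm_comb x y z (a b : R) :
  finitely_supported x -> finitely_supported y -> 0 <= a -> 0 <= b ->
  (forall j, rabs (z j) <= a * rabs (x j) + b * rabs (y j)) ->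
  tnorm z <= a * tnorm x + b * tnorm y.
Proof.
move=> fx fy a0 b0 zxy.
have fz : finitely_supported z.
  have [n xn] := fx; have [m ym] := fy; exists (maxn n m) => j.
  rewrite geq_max => /andP[nj mj]; apply: rabs_eq0; apply/eqP.
  by rewrite eq_le rabs_ge0 andbT (le_trans (zxy j))// xn// ym// rabs0 !mulr0 addr0.
rewrite -lee_fin EFinD !EFinM !tnormE//; exact: tsirelson_norm_comb.
Qed.

Lemma tnorm_mono x z : finitely_supported x ->
  (forall j, rabs (z j) <= rabs (x j)) -> tnorm z <= tnorm x.
Proof.
move=> fx zx; rewrite -lee_fin !tnormE//; first exact: tsirelson_norm_mono.
exact: finitely_supported_le zx.
Qed.

Lemma tnorm_restr I x : finitely_supported x -> tnorm (restr_itv I x) <= tnorm x.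
Proof.
move=> fx; apply: tnorm_mono => // j; rewrite /restr_itv.
by case: ifP; rewrite ?rabs0 ?rabs_ge0.
Qed.

Lemma tnorm0 z : (forall j, z j = 0) -> tnorm z = 0.
Proof.
by move=> z0; rewrite /tnorm (_ : z = fun=> 0) ?tsirelson_norm0//; apply/funext.
Qed.

Lemma tnormZ_le (c : R) x z : finitely_supported x -> 0 <= c ->
  (forall j, rabs (z j) <= c * rabs (x j)) -> tnorm z <= c * tnorm x.
Proof.
move=> fx c0 zx; have := @tnorm_comb x x z c 0 fx fx c0 (lexx _).
by rewrite mul0r addr0; apply => j; rewrite mul0r addr0.
Qed.

Lemma tnorm_le_sum (I : eqType) (r : seq I) (F : I -> nat -> K^o) z :
  (forall i, i \in r -> finitely_supported (F i)) ->
  (forall j, rabs (z j) <= \sum_(i <- r) rabs (F i j)) ->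
  tnorm z <= \sum_(i <- r) tnorm (F i).
Proof.
suff H : forall z, (forall i, i \in r -> finitely_supported (F i)) ->
    (forall j, rabs (z j) <= \sum_(i <- r) rabs (F i j)) ->
    finitely_supported z /\ tnorm z <= \sum_(i <- r) tnorm (F i).
  by move=> fF zF; case: (H z fF zF).
elim: r => [|i r IH] {}z fF zF.
  have z0 j : z j = 0.
    have := zF j; rewrite big_nil => zj.
    by apply: rabs_eq0; apply/eqP; rewrite eq_le rabs_ge0 zj.
  by split; [exists 0%N|rewrite big_nil tnorm0].
pose y : nat -> K^o := fun j => ofR (\sum_(i <- r) rabs (F i j)).
have yE j : rabs (y j) = \sum_(i <- r) rabs (F i j).
  by rewrite rabs_ofR// sumr_ge0// => ? _; exact: rabs_ge0.
have [fy yF] : finitely_supported y /\ tnorm y <= \sum_(i <- r) tnorm (F i).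
  apply: IH => [j jr|j]; last by rewrite yE.
  by apply: fF; rewrite inE jr orbT.
have fi : finitely_supported (F i) by apply: fF; rewrite inE eqxx.
split.
  have [n xn] := fi; have [m ym] := fy; exists (maxn n m) => j.
  rewrite geq_max => /andP[nj mj]; apply: rabs_eq0; apply/eqP.
  rewrite eq_le rabs_ge0 andbT (le_trans (zF j))// big_cons xn// -yE ym// rabs0.
  by rewrite addr0.
rewrite big_cons; apply: (@le_trans _ _ (1 * tnorm (F i) + 1 * tnorm y)).
  by apply: tnorm_comb => // j; have := zF j; rewrite big_cons !mul1r yE.
by rewrite !mul1r lerD2l.
Qed.

Lemma tnorm_l1 x n : (forall j, (n <= j)%N -> x j = 0) ->
  tnorm x <= \sum_(j < n) rabs (x j).
Proof.
move=> xn; rewrite -lee_fin tnormE; last by exists n.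
by apply: ge_ereal_sup => _ [m _ <-]; exact: tsirelson_iter_l1.
Qed.

Lemma tnorm_admissible x s : finitely_supported x -> admissible s ->
  t * \sum_(I <- s) tnorm (restr_itv I x) <= tnorm x.
Proof.
move=> fx ads; rewrite -lee_fin tnormE// EFinM -sumEFin tsirelson_normE//.
under eq_bigr => I _ do rewrite (tnormE (finitely_supported_restr I fx)).
exact: tsirelson_rhs_ge.
Qed.

Lemma tnorm_le x (c : R) : finitely_supported x ->
  (forall j, rabs (x j) <= c) ->
  (forall s, admissible s -> t * \sum_(I <- s) tnorm (restr_itv I x) <= c) ->
  tnorm x <= c.
Proof.
move=> fx xc sc; rewrite -lee_fin tnormE// tsirelson_normE//.
apply: tsirelson_rhs_le => // [|s ads].
  by apply: ge_ereal_sup => _ [j _ <-]; rewrite lee_fin.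
under eq_bigr => I _ do rewrite -(tnormE (finitely_supported_restr I fx)).
by rewrite sumEFin -EFinM lee_fin sc.
Qed.

(** An almost optimal family exists also when the norm is attained by a
    coordinate, at the price of adding the bound [c] on coordinates.  This price is
    low for a sum of many disjoint blocks. *)
Lemma tnorm_adherent x (c e : R) : finitely_supported x -> 0 < e ->
  (forall j, rabs (x j) <= c) ->
  exists2 s, admissible s &
    tnorm x <= c + e + t * \sum_(I <- s) tnorm (restr_itv I x).
Proof.
move=> fx e0 xc; apply: contrapT => H.
have c0 : 0 <= c := le_trans (rabs_ge0 _) (xc 0%N).
have ts s : admissible s ->
    c + e + t * \sum_(I <- s) tnorm (restr_itv I x) < tnorm x.
  by move=> ads; rewrite ltNge; apply/negP => h; apply: H; exists s.
have : tnorm x <= tnorm x - e.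
  apply: tnorm_le => // [j|s /ts].
    have /ts : admissible [::] by [].
    by rewrite big_nil mulr0 addr0 => h; rewrite (le_trans (xc j))// lerBrDr ltW.
  by move=> h; lra.
by rewrite lerBrDr gerDl leNgt e0.
Qed.

(** The sequence [y] is cut, coordinate by coordinate, into at most [m] pieces,
    and the total norm of the pieces is bounded.  Arbitrary pieces are easier to
    cut again than restrictions to disjoint intervals.  The number [m] is the
    one that an admissible family starting before [y] may have: a sequence with
    a small spread is small for all the families that were already open when its
    support begins. *)
Definition spread (m : nat) (M : R) y : Prop :=
  forall zs : seq (nat -> K^o), (size zs <= m)%N ->
    (forall j, \sum_(z <- zs) rabs (z j) <= rabs (y j)) ->
    \sum_(z <- zs) tnorm z <= M.

Lemma le_sum_mem (I : eqType) (r : seq I) (F : I -> R) i : i \in r ->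
  (forall i, 0 <= F i) -> F i <= \sum_(j <- r) F j.
Proof. by move=> ir F0; rewrite (big_rem i)//= lerDl sumr_ge0. Qed.

Lemma spread_l1 m n y : (forall j, (n <= j)%N -> y j = 0) ->
  spread m (\sum_(j < n) rabs (y j)) y.
Proof.
move=> yn zs _ zsy.
have zy z j : z \in zs -> rabs (z j) <= rabs (y j).
  move=> zzs; apply: le_trans (zsy j).
  by apply: (@le_sum_mem _ zs (fun z : nat -> K^o => rabs (z j))) => // ?; exact: rabs_ge0.
apply: (@le_trans _ _ (\sum_(z <- zs) \sum_(j < n) rabs (z j))).
  rewrite big_seq [leRHS]big_seq; apply: ler_sum => z zzs; apply: tnorm_l1 => j nj.
  apply: rabs_eq0; apply/eqP; rewrite eq_le rabs_ge0 andbT.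
  by rewrite (le_trans (zy z j zzs))// yn// rabs0.
by rewrite exchange_big /=; apply: ler_sum => j _; exact: zsy.
Qed.

Lemma spread_scale m M (c : R) y y' : finitely_supported y -> 0 < c ->
  (forall j, rabs (y' j) <= c * rabs (y j)) -> spread m M y -> spread m (c * M) y'.
Proof.
move=> fy c0 y'y sy zs zsm zsy'.
pose sc (z : nat -> K^o) : nat -> K^o := fun j => ofR c^-1 * z j.
have scE z j : rabs (sc z j) = c^-1 * rabs (z j).
  by rewrite rabsM rabs_ofR// invr_ge0 ltW.
have zy z j : z \in zs -> rabs (sc z j) <= rabs (y j).
  move=> zzs; rewrite scE mulrC ler_pdivrMr// mulrC; apply: le_trans (y'y j).
  apply: le_trans (zsy' j).
  by apply: (@le_sum_mem _ zs (fun z : nat -> K^o => rabs (z j))) => // ?; exact: rabs_ge0.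
apply: (@le_trans _ _ (\sum_(z <- zs) c * tnorm (sc z))).
  rewrite big_seq [leRHS]big_seq; apply: ler_sum => z zzs; apply: tnormZ_le.
  - by apply: finitely_supported_le fy _ => j; exact: zy.
  - exact: ltW.
  - by move=> j; rewrite scE mulrA divff ?mul1r// gt_eqF.
rewrite -mulr_sumr ler_wpM2l//; first exact: ltW.
rewrite -(big_map sc xpredT tnorm); apply: sy; first by rewrite size_map.
move=> j; rewrite big_map; under eq_bigr do rewrite scE.
by rewrite -mulr_sumr mulrC ler_pdivrMr// mulrC (le_trans (zsy' j)).
Qed.

(** * Averages of successive blocks *)
Section blocks.
Variables (n : nat) (L : nat -> nat) (y : nat -> nat -> K^o).
Hypothesis Lnd : {homo L : i j / (i <= j)%N}.
Hypothesis ysupp :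
  forall i j, (i < n)%N -> ~~ (L i <= j < L i.+1)%N -> y i j = 0.

Lemma block_uniq i i' j : (L i <= j < L i.+1)%N -> (L i' <= j < L i'.+1)%N -> i = i'.
Proof.
move=> /andP[ij ji] /andP[i'j ji']; apply/eqP; rewrite eqn_leq; apply/andP; split.
  by rewrite leqNgt; apply/negP => /Lnd h; move: (leq_trans ji' (leq_trans h ij)); rewrite ltnn.
by rewrite leqNgt; apply/negP => /Lnd h; move: (leq_trans ji (leq_trans h i'j)); rewrite ltnn.
Qed.

Lemma block_sum i j : (i < n)%N -> (L i <= j < L i.+1)%N ->
  \sum_(i' < n) rabs (y i' j) = rabs (y i j).
Proof.
move=> ni ij; rewrite (bigD1 (Ordinal ni))//= big1 ?addr0// => i' /eqP ii'.
rewrite ysupp ?rabs0//; apply/negP => /(block_uniq ij) h; apply: ii'; exact/val_inj.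
Qed.

Lemma block_sum0 j : (forall i, (i < n)%N -> ~~ (L i <= j < L i.+1)%N) ->
  \sum_(i' < n) rabs (y i' j) = 0.
Proof. by move=> H; apply: big1 => i _; rewrite ysupp ?rabs0// H. Qed.

Lemma blockP j : {i | (i < n)%N & (L i <= j < L i.+1)%N} +
  {forall i, (i < n)%N -> ~~ (L i <= j < L i.+1)%N}.
Proof.
case: (pickP (fun i : 'I_n => (L i <= j < L i.+1)%N)) => [i ij|H].
  by left; exists i.
by right => i ni; rewrite (H (Ordinal ni)).
Qed.

Lemma restr_block_le z j : (forall j, rabs (z j) <= \sum_(i < n) rabs (y i j)) ->
  rabs (z j) <= \sum_(i < n) rabs (restr_itv (L i, L i.+1) z j).
Proof.
move=> zy; have [[i ni ij]|H] := blockP j.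
  apply: le_trans (_ : rabs (restr_itv (L i, L i.+1) z j) <= _).
    by rewrite /restr_itv /= ij.
  by rewrite (bigD1 (Ordinal ni))//= lerDl sumr_ge0// => ? _; exact: rabs_ge0.
have := zy j; rewrite block_sum0// => /le_trans; apply.
by rewrite sumr_ge0// => ? _; exact: rabs_ge0.
Qed.

(** The averaging step (for the sum; dividing by [n] turns the constant into
    [t * M] up to terms of order [m / n]).  Each of the [m] pieces has a
    near-optimal admissible family.  Fix a block [i].  The families with an
    interval starting before [L i] have at most [L i] intervals each, so together
    they cut [y i] into at most [m * L i] pieces, whose total norm is at most [M].
    A family with no interval starting before [L i] contributes on the block
    only if some interval starts before [L i.+1]; this happens for one block per
    family, where the l_1 norm bounds the contribution by 1.  Hence the two terms
    [n%:R * M] and [m%:R] multiplied by [t]; the terms [2 * m%:R] come from the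
    sup norm and from the near-optimality. *)
Lemma spread_blocks m (M : R) Y :
  (forall i, (i < n)%N -> \sum_(j < L i.+1) rabs (y i j) <= 1) ->
  (forall i, (i < n)%N -> spread (m * L i) M (y i)) ->
  (forall j, rabs (Y j) <= \sum_(i < n) rabs (y i j)) ->
  spread m (2 * m%:R + t * (m%:R + n%:R * M)) Y.
Proof.
move=> y1 ysp Yy zs zsm zsY.
have fY : finitely_supported Y.
  exists (L n) => j Lj; apply: rabs_eq0; apply/eqP; rewrite eq_le rabs_ge0 andbT.
  rewrite (le_trans (Yy j))// block_sum0// => i ni; rewrite negb_and -!leqNgt.
  by rewrite (leq_trans (Lnd ni))// orbT.
have zY z j : z \in zs -> rabs (z j) <= rabs (Y j).
  move=> zzs; apply: le_trans (zsY j).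
  by apply: (@le_sum_mem _ zs (fun z : nat -> K^o => rabs (z j))) => // ?; exact: rabs_ge0.
have fz z : z \in zs -> finitely_supported z.
  by move=> zzs; apply: finitely_supported_le fY _ => j; exact: zY.
have Y1 j : rabs (Y j) <= 1.
  apply: le_trans (Yy j) _; have [[i ni ij]|H] := blockP j; last first.
    by rewrite block_sum0// ler01.
  rewrite (block_sum ni ij) (le_trans _ (y1 i ni))//.
  have /andP[_ ji] := ij.
  by rewrite (bigD1 (Ordinal ji))//= lerDl sumr_ge0// => ? _; exact: rabs_ge0.
have /choice[S HS] : forall z, exists s, z \in zs -> admissible s /\
    tnorm z <= 1 + 1 + t * \sum_(I <- s) tnorm (restr_itv I z).
  move=> z; have [zzs|] := boolP (z \in zs); last by exists [::].
  have [j|s ads zs'] := @tnorm_adherent z 1 1 (fz z zzs) ltr01.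
    exact: le_trans (zY z j zzs) (Y1 j).
  by exists s => _.
pose b z i := restr_itv (L i, L i.+1) z.
pose A z i := \sum_(I <- S z) tnorm (restr_itv I (b z i)).
pose st z i := has (fun I => I.1 < L i)%N (S z).
have fb z i I : z \in zs -> finitely_supported (restr_itv I (b z i)).
  by move=> zzs; do 2 apply: finitely_supported_restr; exact: fz.
have bz i j : (i < n)%N -> \sum_(z <- zs) rabs (b z i j) <= rabs (y i j).
  move=> ni; rewrite /b /restr_itv /=; case: (boolP (L i <= j < L i.+1)%N) => ij; last first.
    by rewrite big1 ?rabs_ge0// => z _; rewrite rabs0.
  by rewrite (le_trans (zsY j))// (le_trans (Yy j))// (block_sum ni ij).
have bz1 z i j : z \in zs -> (i < n)%N -> rabs (b z i j) <= rabs (y i j).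
  move=> zzs ni; apply: le_trans (bz i j ni).
  by apply: (@le_sum_mem _ zs (fun z : nat -> K^o => rabs (b z i j))) => // ?; exact: rabs_ge0.
have started i : (i < n)%N -> \sum_(z <- zs | st z i) A z i <= M.
  move=> ni.
  pose zi := flatten [seq [seq restr_itv J (b z i) | J <- S z] |
                      z <- [seq z <- zs | st z i]].
  have -> : \sum_(z <- zs | st z i) A z i = \sum_(z <- zi) tnorm z.
    rewrite /zi big_flatten /= big_map big_filter.
    by apply: eq_bigr => z _; rewrite big_map.
  apply: (ysp i ni) => [|j].
    rewrite /zi size_flatten /shape -map_comp sumnE big_map.
    apply: (@leq_trans (\sum_(z <- [seq z <- zs | st z i]) L i)).
      rewrite big_seq [X in (_ <= X)%N]big_seq; apply: leq_sum => z.
      rewrite mem_filter /= size_map => /andP[/hasP[I IS IL] zzs].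
      have [/andP[/allP/(_ I IS)/andP[_ SI] _] _] := HS z zzs.
      exact: leq_trans SI IL.
    rewrite big_const_seq iter_addn_0 count_predT mulnC leq_mul2r.
    by rewrite (leq_trans _ zsm) ?orbT// size_filter count_size.
  apply: le_trans (bz i j ni); rewrite /zi big_flatten /= big_map big_filter.
  rewrite big_mkcond /= big_seq [leRHS]big_seq; apply: ler_sum => z zzs.
  case: ifP => _; last exact: rabs_ge0.
  by rewrite big_map; apply: admissible_sum_coord; case: (HS z zzs).
(* A family enters its first block once: the right-hand side is the increment
   of [st z], so that these contributions telescope to at most 1. *)
have unstarted z i : z \in zs -> (i < n)%N ->
    (if st z i then 0 else A z i) <= (st z i.+1)%:R - (st z i)%:R.
  move=> zzs ni; have [sti|sti] := boolP (st z i).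
    have -> : st z i.+1.
      apply: sub_has sti => I /leq_trans; apply; exact: Lnd.
    by rewrite subrr.
  rewrite subr0; have [sti'|/hasPn sti'] := boolP (st z i.+1); last first.
    rewrite /A big_seq big1// => I /sti'; rewrite -leqNgt => LI.
    apply: tnorm0 => j; rewrite /b /restr_itv /=; case: ifP => // /andP[Ij _].
    by rewrite ifF// ltnNge (leq_trans LI Ij) andbF.
  apply: le_trans (y1 i ni).
  have bL j : (L i.+1 <= j)%N -> b z i j = 0.
    by move=> Lj; rewrite /b /restr_itv /= ltnNge Lj andbF.
  apply: (@le_trans _ _ (\sum_(I <- S z) \sum_(j < L i.+1) rabs (restr_itv I (b z i) j))).
    apply: ler_sum => I _; apply: tnorm_l1 => j /bL bj.
    by rewrite /restr_itv bj; case: ifP.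
  rewrite exchange_big /=; apply: ler_sum => j _.
  apply: le_trans (bz1 z i j zzs ni).
  by apply: admissible_sum_coord; case: (HS z zzs).
have step1 : \sum_(z <- zs) tnorm z <=
    \sum_(z <- zs) (2 + t * \sum_(i < n) A z i).
  rewrite big_seq [leRHS]big_seq; apply: ler_sum => z zzs.
  have [_ /le_trans->//] := HS z zzs.
  rewrite lerD//; rewrite ler_wpM2l ?(ltW t0)// /A exchange_big /=.
  apply: ler_sum => I _; apply: tnorm_le_sum.
    by move=> i _; exact: fb.
  move=> j; rewrite {1}/restr_itv; case: ifP => Ij; last first.
    by rewrite rabs0 sumr_ge0// => ? _; exact: rabs_ge0.
  apply: le_trans (restr_block_le j _) _.
    by move=> j'; exact: le_trans (zY z j' zzs) (Yy j').
  by apply: ler_sum => i _; rewrite {2}/restr_itv Ij.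
apply: le_trans step1 _; rewrite big_split /= -mulr_sumr.
have szm : (size zs)%:R <= m%:R :> R by rewrite ler_nat.
rewrite big_const_seq count_predT iter_addr addr0 -[_ *+ size zs]mulr_natr.
apply: lerD; first by rewrite ler_pM2l.
rewrite ler_pM2l// exchange_big /=.
have -> : \sum_(i < n) \sum_(z <- zs) A z i =
    \sum_(z <- zs) \sum_(i < n) (if st z i then 0 else A z i) +
    \sum_(i < n) \sum_(z <- zs | st z i) A z i.
  rewrite [X in _ = X + _]exchange_big -big_split /=; apply: eq_bigr => i _.
  rewrite (bigID (fun z => st z i)) /= addrC; congr (_ + _).
  by rewrite [LHS]big_mkcond; apply: eq_bigr => z _; case: (st z i).
apply: lerD.
  apply: le_trans szm; rewrite -sum1_size natr_sum.
  rewrite big_seq [leRHS]big_seq; apply: ler_sum => z zzs.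
  apply: (@le_trans _ _ (\sum_(i < n) ((st z i.+1)%:R - (st z i)%:R))).
    by apply: ler_sum => i _; apply: unstarted.
  rewrite -(big_mkord xpredT (fun i => (st z i.+1)%:R - (st z i)%:R)).
  rewrite telescope_sumr// lerBlDr; case: (st z n); case: (st z 0%N) => //=; lra.
apply: (@le_trans _ _ (\sum_(i < n) M)).
  by apply: ler_sum => i _; exact: started.
by rewrite big_const_ord iter_addr addr0 mulr_natl.
Qed.

(** [cut I.1 i] says that an interval [I] starts strictly inside block [i]: only
    then can two disjoint intervals of a family both meet the block. *)
Let cut p i : R := (L i < p < L i.+1)%N%:R.

Lemma sum_cut p : \sum_(i < n) cut p i <= 1.
Proof.
have cutE i : ~~ (L i <= p < L i.+1)%N -> cut p i = 0.
  by rewrite /cut; case: (boolP (L i < p < L i.+1)%N) => // /andP[/ltnW-> ->].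
have [[i ni ip]|H] := blockP p; last first.
  by rewrite big1 ?ler01// => i _; rewrite cutE// H.
rewrite (bigD1 (Ordinal ni))//= big1 ?addr0 => [|i' /eqP ii'].
  by rewrite /cut lern1 leq_b1.
by rewrite cutE//; apply/negP => /(block_uniq ip) h; apply: ii'; exact/val_inj.
Qed.

(** If no interval of the family starts inside the block, at most one of them,
    namely the one containing [L i], meets it; otherwise the definition of the
    norm gives the bound [t^-1]. *)
Lemma sum_tnorm_block s i : (i < n)%N -> admissible s -> tnorm (y i) <= 1 ->
  \sum_(I <- s) tnorm (restr_itv I (y i)) <= 1 + t^-1 * \sum_(I <- s) cut I.1 i.
Proof.
move=> ni ads y1.
have fy : finitely_supported (y i).
  by exists (L i.+1) => j ij; rewrite ysupp// negb_and -!ltnNge ltnS ij orbT.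
have cut0 p : 0 <= cut p i by exact: ler0n.
have [/hasP[J Js Jc]|/hasPn H] := boolP (has (fun I => L i < I.1 < L i.+1)%N s).
  apply: (@le_trans _ _ t^-1).
    by rewrite -[leRHS]mulr1 mulrC ler_pdivlMr// mulrC (le_trans (tnorm_admissible fy ads)).
  apply: (@le_trans _ _ (t^-1 * \sum_(I <- s) cut I.1 i)); last by rewrite lerDr.
  rewrite ler_pMr ?invr_gt0//.
  have := @le_sum_mem _ s (fun I => cut I.1 i) J Js (fun I => cut0 I.1).
  by rewrite {1}/cut Jc.
apply: (@le_trans _ _ 1); last by rewrite lerDl mulr_ge0 ?invr_ge0 ?(ltW t0)// sumr_ge0.
have <- : rabs ((fun=> 1 : K^o) (L i)) = 1 by rewrite -[1]ofR1 rabs_ofR.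
apply: le_trans (admissible_sum_coord (fun=> 1 : K^o) (L i) ads).
rewrite big_seq [leRHS]big_seq; apply: ler_sum => I Is.
rewrite {2}/restr_itv; case: ifPn => Ii.
  by rewrite -[1]ofR1 rabs_ofR// (le_trans (tnorm_restr I fy)).
rewrite rabs0 tnorm0// => j; rewrite /restr_itv; case: ifP => // /andP[Ij jI].
apply: ysupp => //; apply/negP => /andP[ij ji].
move: Ii; rewrite negb_and -!ltnNge ltnS => /orP[Ii|Ii].
  by have := H I Is; rewrite Ii (leq_ltn_trans Ij ji).
by move: (leq_ltn_trans Ii (leq_ltn_trans ij jI)); rewrite ltnn.
Qed.

(** An admissible family that meets the support of [y0] has at most [L 0]
    intervals, hence cuts at most [L 0] of the blocks; each of the others lies in
    a single interval as far as it is met at all, and counts for its norm, at most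
    1.  So the average contributes [t] and an error of [L 0 / n].  A family that
    starts after [y0] sees the average only. *)
Lemma tnorm_average y0 Y : (0 < n)%N ->
  (forall j, (L 0 <= j)%N -> y0 j = 0) -> tnorm y0 <= 1 ->
  (forall i, (i < n)%N -> tnorm (y i) <= 1) ->
  (forall j, rabs (Y j) <= rabs (y0 j) + n%:R^-1 * \sum_(i < n) rabs (y i j)) ->
  tnorm Y <= 1 + t + (L 0)%:R / n%:R.
Proof.
move=> n0 y00 y01 y1 Yy.
have n0' : 0 < n%:R :> R by rewrite ltr0n.
have ni0 : 0 < n%:R^-1 :> R by rewrite invr_gt0.
have n1 : n%:R^-1 <= 1 :> R by rewrite invf_le1// ler1n.
have fy0 : finitely_supported y0 by exists (L 0).
have fy i : (i < n)%N -> finitely_supported (y i).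
  by move=> ni; exists (L i.+1) => j ij; rewrite ysupp// negb_and -!ltnNge ltnS ij orbT.
pose W : nat -> K^o := fun j => ofR (\sum_(i < n) rabs (y i j)).
have WE j : rabs (W j) = \sum_(i < n) rabs (y i j).
  by rewrite rabs_ofR// sumr_ge0// => ? _; exact: rabs_ge0.
have W0 j : (L n <= j)%N -> W j = 0.
  move=> nj; rewrite /W block_sum0 ?ofR0// => i ni; rewrite negb_and -!leqNgt.
  by rewrite (leq_trans (Lnd ni))// orbT.
have fW : finitely_supported W by exists (L n).
have fY : finitely_supported Y.
  exists (L n) => j nj; apply: rabs_eq0; apply/eqP; rewrite eq_le rabs_ge0 andbT.
  rewrite (le_trans (Yy j))// -WE W0// rabs0 mulr0 addr0 y00 ?rabs0//.
  by rewrite (leq_trans _ nj)// Lnd.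
have c1 : 1 <= 1 + t + (L 0)%:R / n%:R.
  by rewrite -addrA lerDl addr_ge0 ?(ltW t0)// mulr_ge0.
apply: tnorm_le => // [j|s ads].
  apply: le_trans c1; apply: le_trans (Yy j) _.
  have [[i ni ij]|H] := blockP j.
    rewrite y00 ?rabs0 ?add0r; last first.
      by have /andP[ij' _] := ij; rewrite (leq_trans _ ij')// Lnd.
    rewrite (block_sum ni ij) mulr_ile1 ?rabs_ge0// ?(ltW ni0)//.
    exact: le_trans (tnorm_coord j (fy i ni)) (y1 i ni).
  by rewrite block_sum0// mulr0 addr0 (le_trans (tnorm_coord j fy0)).
have IW I : tnorm (restr_itv I W) <= \sum_(i < n) tnorm (restr_itv I (y i)).
  apply: tnorm_le_sum => // [i _|j].
    exact/finitely_supported_restr/fy.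
  rewrite /restr_itv; case: ifP => _; first by rewrite WE.
  by rewrite rabs0 sumr_ge0// => ? _; exact: rabs_ge0.
have IY I : tnorm (restr_itv I Y) <= 1 * tnorm (restr_itv I y0) +
    n%:R^-1 * tnorm (restr_itv I W).
  apply: tnorm_comb; rewrite ?(ltW ni0)//; try exact: finitely_supported_restr.
  move=> j; rewrite mul1r /restr_itv; case: ifP => _; last by rewrite rabs0 mulr0 addr0.
  by rewrite WE.
have exch : \sum_(I <- s) tnorm (restr_itv I W) <=
    \sum_(i < n) \sum_(I <- s) tnorm (restr_itv I (y i)).
  by rewrite exchange_big /=; apply: ler_sum => I _.
apply: (@le_trans _ _ (t * \sum_(I <- s) tnorm (restr_itv I y0) +
    t * (n%:R^-1 * \sum_(i < n) \sum_(I <- s) tnorm (restr_itv I (y i))))).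
  rewrite -mulrDr ler_pM2l//; apply: (@le_trans _ _ (\sum_(I <- s)
    (1 * tnorm (restr_itv I y0) + n%:R^-1 * tnorm (restr_itv I W)))).
    by apply: ler_sum => I _.
  by rewrite big_split /= -!mulr_sumr mul1r lerD2l ler_pM2l.
have [/hasP[J Js JL]|/hasPn H] := boolP (has (fun I => I.1 < L 0)%N s); last first.
  rewrite big_seq big1 ?mulr0 ?add0r; last first.
    move=> I Is; apply: tnorm0 => j; rewrite /restr_itv; case: ifP => // /andP[Ij _].
    by rewrite y00// (leq_trans _ Ij)// leqNgt H.
  apply: le_trans c1; rewrite mulrCA mulrC ler_pdivrMr// mul1r mulr_sumr.
  rewrite -[X in _ <= X%:R]card_ord -sumr_const.
  by apply: ler_sum => i _; rewrite (le_trans (tnorm_admissible (fy i _) ads))// y1.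
have sL : (size s <= L 0)%N.
  have /andP[/allP/(_ J Js)/andP[_ sJ] _] := ads; exact: leq_trans sJ JL.
rewrite -addrA; apply: lerD; first exact: le_trans (tnorm_admissible fy0 ads) y01.
apply: (@le_trans _ _ (t * (n%:R^-1 * \sum_(i < n) (1 + t^-1 * \sum_(I <- s) cut I.1 i)))).
  rewrite ler_pM2l// ler_pM2l//; apply: ler_sum => i _.
  by apply: sum_tnorm_block => //; exact: y1.
rewrite big_split /= sumr_const card_ord -mulr_sumr exchange_big /=.
rewrite mulrDr mulVf ?gt_eqF// mulrDr mulr1 lerD2l.
set S := \sum_(I <- s) _.
have -> : t * (n%:R^-1 * (t^-1 * S)) = S / n%:R.
  by rewrite mulrCA [t * _]mulrA mulfV ?gt_eqF// mul1r mulrC.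
rewrite ler_pM2r// /S.
apply: (@le_trans _ _ (\sum_(I <- s) 1)); first by apply: ler_sum => I _; exact: sum_cut.
by rewrite big_const_seq count_predT iter_addr addr0 ler_nat.
Qed.
End blocks.
End tsirelson_real.

(** * The space T_{q,theta} *)
Section convexified.
Context {R : realType} {k : scalar_kind} (q theta : R).
Hypothesis (q1 : 1 <= q) (theta01 : 0 < theta < 1).
Local Notation K := (scalars R k).
Local Notation T := (tsirelson_conv k q1 theta01).
Local Notation t := (theta `^ q).
Implicit Types x y z : T.

Let q0 : 0 < q. Proof. exact: lt_le_trans q1. Qed.

Lemma powR_theta01 : 0 < t < 1.
Proof.
have /andP[th0 th1] := theta01; rewrite powR_gt0//=.
have -> : 1 = 1 `^ q :> R by rewrite powR1.
by rewrite gt0_ltr_powR// ?nnegrE// ltW.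
Qed.

Lemma tsirelson_addE x y j : (x + y) j = x j + y j.
Proof. by []. Qed.

Lemma tsirelson_sumE n (y : nat -> T) j : (\sum_(i < n) y i) j = \sum_(i < n) y i j.
Proof.
elim: n => [|n IH]; first by rewrite !big_ord0.
by rewrite !big_ord_recr /= -IH.
Qed.

Lemma tsirelson_ext x y : (forall j, x j = y j) -> x = y.
Proof. by move=> xy; apply/val_inj/funext. Qed.

Lemma finite_tsirelson_conv (u : nat -> K^o) : finitely_supported u ->
  u \in tsirelson_conv_pred (k := k) q1 theta01.
Proof.
move=> [n un]; apply/asboolP => e e0; exists (power_seq q u).
  by exists n => j /un uj; rewrite /power_seq uj rabs0 powR0 ?ofR0// gt_eqF.
rewrite subrr tsirelson_norm0//.
by have /andP[] := powR_theta01.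
Qed.

(** Solidity of the space, which allows the restriction of its elements to
    arbitrary sets of coordinates. *)
Lemma dominated_tsirelson_conv x (u : nat -> K^o) : (forall j, rabs (u j) <= rabs (x j)) ->
  u \in tsirelson_conv_pred (k := k) q1 theta01.
Proof.
move=> ux; apply/asboolP.
apply: (@tsirelson_space_comb _ _ _ _ theta01 (power_seq q x) (power_seq q x) _ 1 0) => //.
- move=> j; rewrite mul1r mul0r addr0 !rabs_power_seq.
  by rewrite ge0_ler_powR ?nnegrE ?rabs_ge0// ltW.
- exact: (tsirelson_seqP x).
- exact: (tsirelson_seqP x).
Qed.

Lemma finitely_supported_delta i :
  finitely_supported ((fun j => (j == i)%:R) : nat -> K^o).
Proof. by exists i.+1 => j ij; rewrite gtn_eqF. Qed.

Definition basisT (i : nat) : T :=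
  TsirelsonConv (finite_tsirelson_conv (finitely_supported_delta i)).

Lemma maskT_le (A : pred nat) x j :
  rabs ((if A j then x j else 0) : K^o) <= rabs (x j).
Proof. by case: ifP; rewrite ?rabs0 ?rabs_ge0. Qed.

Definition maskT (A : pred nat) x : T :=
  TsirelsonConv (dominated_tsirelson_conv (u := fun j => if A j then x j else 0) (maskT_le A x)).

Lemma maskTE A x j : maskT A x j = if A j then x j else 0.
Proof. by []. Qed.

Lemma maskT_split A x : x = maskT A x + maskT (predC A) x.
Proof.
apply: tsirelson_ext => j; rewrite tsirelson_addE !maskTE /=.
by case: ifP; rewrite ?addr0 ?add0r.
Qed.

Lemma rnormT_powR x : rnorm x `^ q = tnorm t (power_seq q x).
Proof. rewrite rnorm_tsirelson; exact: tsirelson_conv_normK. Qed.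

Lemma tnormTE x : (tnorm t (power_seq q x))%:E = tsirelson_norm t (power_seq q x).
Proof. exact: (fine_tsirelson q1 theta01 (tsirelson_seqP x)). Qed.

Lemma rnormT_le x (c : R) : 0 <= c -> tnorm t (power_seq q x) <= c `^ q -> rnorm x <= c.
Proof.
move=> c0 xc; rewrite rnorm_tsirelson; apply: tsirelson_conv_norm_le => //.
by rewrite -tnormTE lee_fin.
Qed.

Lemma rnormT_mono x z : (forall j, rabs (z j) <= rabs (x j)) -> rnorm z <= rnorm x.
Proof.
move=> zx; apply: rnormT_le; first exact: rnorm_ge0.
rewrite rnormT_powR -lee_fin !tnormTE; apply: tsirelson_norm_mono.
  by have /andP[] := powR_theta01.
move=> j; rewrite !rabs_power_seq ge0_ler_powR ?nnegrE ?rabs_ge0//; exact: ltW.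
Qed.

Lemma rnorm_maskT A x : rnorm (maskT A x) <= rnorm x.
Proof. by apply: rnormT_mono => j; rewrite maskTE maskT_le. Qed.

Lemma rabs_coordT x j : rabs (x j) <= rnorm x.
Proof.
have : rabs (power_seq q x j) <= tnorm t (power_seq q x).
  by rewrite -lee_fin tnormTE; exact: rabs_tsirelson_norm.
rewrite rabs_power_seq -rnormT_powR => h.
have := @ge0_ler_powR R q^-1; rewrite invr_ge0 => /(_ (ltW q0)) H.
have := H _ _ _ _ h; rewrite !nnegrE !powR_ge0 -!powRrM !mulfV ?gt_eqF//.
by rewrite !powRr1 ?rabs_ge0 ?rnorm_ge0//; exact.
Qed.

Lemma coordT_dual j : (fun x : T => x j : K^o) \in @dual_pred R k T.
Proof.
apply: (@bounded_dual_pred _ _ _ _ 1) => // x.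
by rewrite mul1r rabs_coordT.
Qed.

Definition coordT j : dual T := Dual (coordT_dual j).

Lemma coordTE j x : coordT j x = x j.
Proof. by []. Qed.

Lemma rnorm_coordT j : rnorm (coordT j) <= 1.
Proof.
by rewrite rnorm_dual; apply: dual_norm_le => // x; rewrite mul1r coordTE rabs_coordT.
Qed.

Lemma tail_small x (e : R) : 0 < e -> exists n, rnorm (maskT (fun j => n <= j)%N x) <= e.
Proof.
move=> e0; have eq0 : 0 < e `^ q by exact: powR_gt0.
have [u [n un] xu] := tsirelson_seqP x eq0; exists n.
apply: rnormT_le; first exact: ltW.
rewrite -lee_fin tnormTE; apply: le_trans (ltW xu).
apply: tsirelson_norm_mono => [|j]; first by have /andP[] := powR_theta01.
rewrite rabs_power_seq maskTE -[(power_seq q x - u) j]/(power_seq q x j - u j).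
case: ifPn => nj; last by rewrite rabs0 powR0 ?rabs_ge0 ?gt_eqF.
by rewrite un// subr0 rabs_power_seq.
Qed.

(** The definition of the Tsirelson norm, read after [q]-convexification as a
    lower [q]-estimate on admissible families. *)
Lemma sum_maskT_admissible x s : admissible s ->
  \sum_(I <- s) rnorm (maskT (fun j => I.1 <= j < I.2)%N x) `^ q <= (theta^-1 * rnorm x) `^ q.
Proof.
move=> ads; have /andP[t0 _] := powR_theta01; have /andP[th0 _] := theta01.
have -> : (theta^-1 * rnorm x) `^ q = t^-1 * tnorm t (power_seq q x).
  rewrite powRM ?invr_ge0 ?(ltW th0)//; last exact: rnorm_ge0.
  by rewrite -rnormT_powR -powR_inv1 ?(ltW th0)// -powRrM mulN1r powRN.
rewrite -ler_pdivrMl ?invr_gt0// invrK -lee_fin EFinM -sumEFin tnormTE tsirelson_normE//.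
apply: le_trans (tsirelson_rhs_ge t0 _ _ ads); rewrite lee_wpmul2l// ?lee_fin ?(ltW t0)//.
apply: lee_sum => I _; rewrite rnormT_powR tnormTE; apply: tsirelson_norm_mono => // j.
rewrite rabs_power_seq maskTE /restr_itv; case: ifP => _; first by rewrite rabs_power_seq.
by rewrite rabs0 powR0// gt_eqF.
Qed.

(** At each coordinate at most one term of a block sum is nonzero, so taking
    [q]-th powers of moduli is additive on it; this is how estimates on
    [power_seq] pass to T_{q,theta}. *)
Lemma power_block_sum n (L : nat -> nat) (y : nat -> T) j : {homo L : i j / (i <= j)%N} ->
  (forall i j, (i < n)%N -> ~~ (L i <= j < L i.+1)%N -> y i j = 0) ->
  rabs ((\sum_(i < n) y i) j) `^ q = \sum_(i < n) rabs (power_seq q (y i) j).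
Proof.
move=> Lnd ys; rewrite tsirelson_sumE.
have [[i ni ij]|H] := blockP n L j.
  rewrite (bigD1 (Ordinal ni))//= [in RHS](bigD1 (Ordinal ni))//=.
  have y0 i' : i' != Ordinal ni -> y i' j = 0.
    move=> /eqP ii'; rewrite ys//; apply/negP => /(block_uniq Lnd ij) h.
    by apply: ii'; exact/val_inj.
  rewrite [X in rabs (_ + X)]big1 ?addr0 => [|i' /y0//].
  rewrite [X in _ = _ + X]big1 ?addr0 ?rabs_power_seq// => i' /y0 yi'.
  by rewrite rabs_power_seq yi' rabs0 powR0// gt_eqF.
rewrite big1 => [|i _]; last by rewrite ys// H.
rewrite rabs0 powR0 ?gt_eqF// big1// => i _.
by rewrite rabs_power_seq ys ?H// rabs0 powR0// gt_eqF.
Qed.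
End convexified.

(** * Functionals are small on tails *)
Lemma ofR_sum (R : realType) (k : scalar_kind) (I : Type) (r : seq I) (F : I -> R) :
  ofR (\sum_(i <- r) F i) = \sum_(i <- r) ofR (F i) :> scalars R k.
Proof. by elim: r => [|i r IH]; rewrite ?big_nil ?ofR0// !big_cons ofRD IH. Qed.

Section shrinking.
Context {R : realType} {k : scalar_kind} (q theta : R).
Hypothesis (q1 : 1 <= q) (theta01 : 0 < theta < 1).
Local Notation K := (scalars R k).
Local Notation T := (tsirelson_conv k q1 theta01).
Local Notation t := (theta `^ q).
Implicit Types (x y z : T) (f : dual T).

Let q0 : 0 < q. Proof. exact: lt_le_trans q1. Qed.
Let t01 : 0 < t < 1. Proof. exact: powR_theta01. Qed.

Definition tail_bounded f (c : R) N := forall x, finitely_supported x ->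
  (forall j, (j < N)%N -> x j = 0) -> rabs (f x) <= c * rnorm x.

(** If no tail satisfied the better bound, there would be normalised blocks
    [x0], [y 0], [y 1], ... with values of [f] above [rho * c], where
    [rho = (3 + t) / 4].  Then [f] exceeds [2 * rho * c] at
    [x0 + n^-1 (y 0 + ... + y (n-1))], whose norm is at most
    [1 + t + (1 - t) / 2 = 2 * rho] for large [n]. *)
Lemma tail_bounded_step f c N : 0 < c -> tail_bounded f c N ->
  exists N', tail_bounded f ((3 + t) / 4 * c) N'.
Proof.
move=> c0 fcN; set rho := (3 + t) / 4; apply: contrapT => H.
have /andP[t0 t1] := t01.
have rho0 : 0 < rho by rewrite /rho; lra.
have /choice[nxt Hn] : forall M, exists d : T * nat * R,
    [/\ forall j, ~~ (M <= j < d.1.2)%N -> d.1.1 j = 0, (M <= d.1.2)%N,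
        rnorm d.1.1 <= 1, f d.1.1 = ofR d.2 & rho * c < d.2].
  move=> M; apply: contrapT => HM; apply: H; exists M => x [m xm] xM.
  rewrite leNgt; apply/negP => fx; apply: HM.
  have fx0 : 0 < rabs (f x).
    by apply: le_lt_trans fx; rewrite mulr_ge0 ?rnorm_ge0// mulr_ge0 ?ltW.
  have x0 : 0 < rnorm x.
    rewrite lt_neqAle eq_sym rnorm_ge0 andbT; apply/eqP => x0.
    by have := rabs_dual_le f x; rewrite x0 mulr0 leNgt fx0.
  have fxn0 : f x != 0 by apply/eqP => E; move: fx0; rewrite E rabs0 ltxx.
  pose a : K := ofR (rabs (f x) / rnorm x) / f x.
  have ra : rabs a = (rnorm x)^-1.
    apply: (mulIf (lt0r_neq0 fx0)); rewrite -rabsM /a divfK// rabs_ofR.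
      by rewrite mulrC.
    by rewrite divr_ge0 ?rabs_ge0 ?rnorm_ge0.
  exists (a *: x, maxn M m, rabs (f x) / rnorm x); split=> /=.
  - move=> j; rewrite negb_and -!ltnNge ltnS geq_max => h.
    rewrite -[LHS]/(a * x j).
    by case/orP: h => [/xM->|/andP[_ /xm->]]; rewrite mulr0.
  - exact: leq_maxl.
  - by rewrite rnormZ ra mulVf// gt_eqF.
  - by rewrite linearZ /= /a -[LHS]/(_ * _) divfK.
  - by rewrite ltr_pdivlMr.
pose L i := iter i (fun M => (nxt M).1.2) (nxt N).1.2.
pose x0 := (nxt N).1.1; pose r0 := (nxt N).2.
pose y i := (nxt (L i)).1.1; pose r i := (nxt (L i)).2.
have LS i : L i.+1 = (nxt (L i)).1.2 by [].
have Lnd : {homo L : i j / (i <= j)%N}.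
  by apply: homo_leq => // [i j l|i]; [exact: leq_trans|rewrite LS; case: (Hn (L i))].
have ysupp i j : ~~ (L i <= j < L i.+1)%N -> y i j = 0.
  by rewrite LS; case: (Hn (L i)) => + _ _ _ _; apply.
have [x0s NL x01 fx0 cr0] := Hn N.
have x0L j : (L 0 <= j)%N -> x0 j = 0.
  by move=> Lj; apply: x0s; rewrite negb_and -!ltnNge ltnS Lj orbT.
pose n := (Num.truncn ((L 0)%:R / ((1 - t) / 2))).+1.
have nt : (L 0)%:R / n%:R <= (1 - t) / 2.
  have e0 : 0 < (1 - t) / 2 by lra.
  rewrite ler_pdivrMr ?ltr0n// mulrC -ler_pdivrMr// ltW//.
  by have /truncn_itv/andP[] : 0 <= (L 0)%:R / ((1 - t) / 2) by rewrite divr_ge0// ltW.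
have n0 : 0 < n%:R :> R by rewrite ltr0n.
pose X : T := x0 + ofR (n%:R^-1) *: \sum_(i < n) y i.
have Xj j : X j = x0 j + ofR n%:R^-1 * (\sum_(i < n) y i) j by [].
have fX : f X = ofR (r0 + n%:R^-1 * \sum_(i < n) r i).
  rewrite /X linearD linearZ linear_sum /= ofRD ofRM ofR_sum -fx0; congr (_ + _ * _).
  by apply: eq_bigr => i _; case: (Hn (L i)).
have big : 2 * rho * c < r0 + n%:R^-1 * \sum_(i < n) r i.
  have : rho * c <= n%:R^-1 * \sum_(i < n) r i.
    rewrite [leRHS]mulrC ler_pdivlMr// mulr_natr -[X in _ *+ X]card_ord -sumr_const.
    by apply: ler_sum => i _; case: (Hn (L i)) => _ _ _ _ /ltW.
  by move: cr0; rewrite -/r0; lra.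
have XL j : (L n <= j)%N -> X j = 0.
  move=> nj; rewrite Xj x0L ?(leq_trans _ nj) ?Lnd// tsirelson_sumE big1 ?mulr0 ?addr0// => i _.
  by rewrite ysupp// negb_and -!ltnNge ltnS (leq_trans _ nj) ?orbT// Lnd.
have XN j : (j < N)%N -> X j = 0.
  move=> jN; rewrite Xj x0s ?negb_and -?ltnNge ?jN// tsirelson_sumE big1 ?mulr0 ?addr0// => i _.
  by rewrite ysupp// negb_and -ltnNge (leq_trans jN)// (leq_trans NL)// (Lnd 0%N).
have nX : rnorm X <= 2 * rho.
  have r1 : 1 <= 2 * rho by rewrite /rho; lra.
  apply: rnormT_le; first by lra.
  apply: (@le_trans _ _ (2 * rho)); last first.
    by rewrite -[leLHS]powRr1 ?ler_powR//; lra.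
  have le1 x : rnorm x <= 1 -> tnorm t (power_seq q x) <= 1.
    move=> x1; rewrite -rnormT_powR; have -> : 1 = 1 `^ q :> R by rewrite powR1.
    by rewrite ge0_ler_powR ?nnegrE ?rnorm_ge0// ltW.
  have ps0 x j : x j = 0 -> power_seq q x j = 0.
    by rewrite /power_seq => ->; rewrite rabs0 powR0 ?ofR0// gt_eqF.
  apply: (@le_trans _ _ (1 + t + (L 0)%:R / n%:R)); last by rewrite /rho; lra.
  apply: (@tnorm_average _ _ t t01 n L (fun i => power_seq q (y i)) Lnd _ (power_seq q x0)) => //.
  - by move=> i j _ ij; apply/ps0/ysupp.
  - by move=> j Lj; apply/ps0/x0L.
  - exact: le1.
  - by move=> i _; apply: le1; case: (Hn (L i)).
  - move=> j; rewrite -(power_block_sum j Lnd (fun i j _ => @ysupp i j)) !rabs_power_seq Xj.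
    have [jL|Lj] := ltnP j (L 0).
      rewrite tsirelson_sumE big1 ?mulr0 ?addr0 ?rabs0.
        by rewrite lerDl mulr_ge0 ?powR_ge0 ?invr_ge0 ?(ltW n0)//
          sumr_ge0// => i _; exact: rabs_ge0.
      by move=> i _; rewrite ysupp// negb_and -ltnNge (leq_trans jL)// Lnd.
    rewrite x0L// rabs0 powR0 ?gt_eqF// !add0r rabsM rabs_ofR ?invr_ge0 ?(ltW n0)//.
    by rewrite ge1r_powRZ ?rabs_ge0// invr_gt0 n0 invf_le1// ler1n.
have XX : rabs (f X) <= c * (2 * rho).
  have fXs : finitely_supported X by exists (L n).
  by rewrite (le_trans (fcN X fXs XN))// ler_pM2l.
move: XX; rewrite fX leNgt => /negP; apply.
have rg0 : 0 <= r0 + n%:R^-1 * \sum_(i < n) r i.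
  by apply: ltW; apply: le_lt_trans big; apply: mulr_ge0; [apply: mulr_ge0 => //|]; exact: ltW.
by rewrite rabs_ofR// mulrC.
Qed.

Lemma shrinking f (e : R) : 0 < e -> exists N, forall x,
  (forall j, (j < N)%N -> x j = 0) -> rabs (f x) <= e * rnorm x.
Proof.
move=> e0; have /andP[t0 t1] := t01; set rho := (3 + t) / 4.
have rho0 : 0 < rho by rewrite /rho; lra.
pose c := dual_norm f + 1.
have c0 : 0 < c by rewrite ltr_wpDl// dual_norm_ge0.
have H i : exists N, tail_bounded f (rho ^+ i * c) N.
  elim: i => [|i [N HN]].
    exists 0%N => x _ _; rewrite expr0 mul1r (le_trans (rabs_dual_le f x))//.
    by rewrite ler_wpM2r ?rnorm_ge0// lerDl.
  by rewrite exprS -mulrA; apply: tail_bounded_step HN; rewrite mulr_gt0// exprn_gt0.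
have [i ie] : exists i, rho ^+ i * c <= e.
  have /cvgrPdist_lt/(_ (e / c)) : (GRing.exp rho : nat -> R) @ \oo --> (0 : R).
    by apply: cvg_expr; rewrite gtr0_norm// /rho; lra.
  rewrite divr_gt0// => /(_ isT) [i _ /(_ i (leqnn i))] /=.
  rewrite sub0r normrN ger0_norm ?exprn_ge0 ?(ltW rho0)// => ie.
  by exists i; rewrite -ler_pdivlMr// ltW.
have [N HN] := H i; exists N => x xN; apply/ler_addgt0Pr => d d0.
have dc0 : 0 < d / c by rewrite divr_gt0.
have [n xn] := tail_small x dc0.
rewrite {1}(maskT_split (fun j => n <= j)%N x) linearD addrC.
rewrite (le_trans (ler_rabsD _ _))// lerD//.
  apply: le_trans (HN _ _ _) _.
  - by exists n => j nj; rewrite maskTE /= nj.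
  - by move=> j /xN xj; rewrite maskTE xj; case: ifP.
  - by rewrite ler_pM ?rnorm_ge0 ?rnorm_maskT// mulr_ge0 ?exprn_ge0 ?ltW.
rewrite (le_trans (rabs_dual_le f _))//.
apply: (@le_trans _ _ (c * (d / c))); last by rewrite mulrC divfK// gt_eqF.
by rewrite ler_pM ?dual_norm_ge0 ?rnorm_ge0// lerDl.
Qed.
End shrinking.

(** * Finite Hoelder inequality for the conjugate exponents of the games *)
Section hoelder_finite.
Context {R : realType} {k : scalar_kind}.
Local Notation K := (scalars R k).

Lemma fine_hoelder_conjugate (r : R) : 1 < r ->
  r^-1 + (fine (hoelder_conjugate r%:E))^-1 = 1.
Proof.
move=> r1; have r0 : 0 < r by lra.
rewrite /hoelder_conjugate/= gt_eqF// inver subr_eq0 gt_eqF//= invf_div.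
by rewrite mulrBl divff ?gt_eqF// mul1r addrC subrK.
Qed.

(** Young's inequality, summed after rescaling by [B]. *)
Lemma lp_norm_pairing (p : \bar R) q n (a : 'I_n -> K) (s : 'I_n -> R) (B : R) :
  (1 < p)%E -> q = fine (hoelder_conjugate p) -> 0 <= B -> (forall i, 0 <= s i) ->
  \sum_(i < n) s i `^ q <= B `^ q -> lp_norm p a <= 1 ->
  \sum_(i < n) rabs (a i) * s i <= B.
Proof.
move=> p1 -> B0 s0; case: p p1 => [r| |//]; last first.
  rewrite hoelder_conjugatey /= powRr1// => _; under eq_bigr do rewrite powRr1//.
  move=> sB a1; apply: le_trans sB; apply: ler_sum => i _; rewrite ler_piMl//.
  exact: le_trans (le_bigmax _ _ _) a1.
rewrite lte_fin => r1; set q' := fine _; have pq := fine_hoelder_conjugate r1.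
rewrite -/q' in pq; have r0 : 0 < r by lra.
have q0 : 0 < q'.
  rewrite -invr_gt0; have -> : q'^-1 = 1 - r^-1 by rewrite -pq addrAC subrr add0r.
  by rewrite subr_gt0 invf_lt1.
move=> sB; rewrite /lp_norm => a1.
have {}a1 : \sum_(i < n) rabs (a i) `^ r <= 1.
  have S0 : 0 <= \sum_(i < n) rabs (a i) `^ r by rewrite sumr_ge0// => i _; exact: powR_ge0.
  have -> : \sum_(i < n) rabs (a i) `^ r = ((\sum_(i < n) rabs (a i) `^ r) `^ r^-1) `^ r.
    by rewrite -powRrM mulVf ?gt_eqF// powRr1.
  apply: (@le_trans _ _ (1 `^ r)); last by rewrite powR1.
  by rewrite ge0_ler_powR// ?nnegrE ?powR_ge0// ltW.
have [B00|Bn0] := eqVneq B 0.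
  rewrite big1 ?B0// => i _; move: sB; rewrite B00 powR0 ?gt_eqF// => sB.
  have si : s i `^ q' <= 0.
    apply: le_trans sB; rewrite (bigD1 i)//= lerDl sumr_ge0// => j _; exact: powR_ge0.
  have : s i `^ q' = 0 by apply/eqP; rewrite eq_le si powR_ge0.
  by move/powR_eq0_eq0 ->; rewrite mulr0.
have Bp : 0 < B by rewrite lt_neqAle eq_sym Bn0.
rewrite -[leRHS]mul1r -ler_pdivrMr// mulr_suml.
apply: (@le_trans _ _ (\sum_(i < n) (rabs (a i) `^ r / r + (s i / B) `^ q' / q'))).
  apply: ler_sum => i _; rewrite -mulrA; apply: conjugate_powR => //.
  - exact: rabs_ge0.
  - by rewrite divr_ge0.
rewrite big_split /= -!mulr_suml -[leRHS]pq; apply: lerD.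
  by rewrite ler_pdivrMr// mulVf ?gt_eqF.
rewrite ler_pdivrMr// mulVf ?gt_eqF//.
under eq_bigr do rewrite powRM// ?invr_ge0 ?(ltW Bp)//.
have -> : B^-1 `^ q' = (B `^ q')^-1 by rewrite -powR_inv1// -powRrM mulN1r powRN.
by rewrite -mulr_suml ler_pdivrMr ?powR_gt0// mul1r.
Qed.

Lemma lp_norm_coord (p : \bar R) n (a : 'I_n -> K) i : (1 < p)%E ->
  lp_norm p a <= 1 -> rabs (a i) <= 1.
Proof.
case: p => [r| |//] p1 /=; last by apply: le_trans; exact: le_bigmax.
move: p1; rewrite lte_fin => r1; have r0 : 0 < r by lra.
have -> : rabs (a i) = (rabs (a i) `^ r) `^ r^-1.
  by rewrite -powRrM mulfV ?gt_eqF// powRr1// rabs_ge0.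
apply: le_trans; rewrite ge0_ler_powR ?nnegrE ?powR_ge0 ?invr_ge0 ?(ltW r0)//.
  by rewrite sumr_ge0// => j _; exact: powR_ge0.
by rewrite (bigD1 i)//= lerDl sumr_ge0// => j _; exact: powR_ge0.
Qed.

(** The coefficients n^(-1/p) and n^(-1/q) of the averages in the dual and in
    the space multiply to 1/n, the coefficient of a convex average. *)
Lemma proot_conjugate (p : \bar R) q n : (1 < p)%E -> q = fine (hoelder_conjugate p) ->
  proot p n * n%:R `^ q^-1 = n%:R.
Proof.
move=> p1 ->; case: p p1 => [r| |//]; last first.
  by rewrite hoelder_conjugatey /= invr1 mul1r powRr1.
rewrite lte_fin => r1; have := fine_hoelder_conjugate r1; set q' := fine _ => pq /=.
have [->|n0] := posnP n.
  by rewrite powR0 ?mul0r// invr_eq0 gt_eqF//; lra.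
by rewrite -powRD pq ?powRr1// oner_eq0.
Qed.
End hoelder_finite.

(** * The dual of T_{q,theta} has A_p and infinite dimension *)
Lemma ler_rabs_sum (R : realType) (k : scalar_kind) (I : Type) (r : seq I)
  (F : I -> scalars R k) : rabs (\sum_(i <- r) F i) <= \sum_(i <- r) rabs (F i).
Proof.
elim: r => [|i r IH]; first by rewrite !big_nil rabs0.
by rewrite !big_cons (le_trans (ler_rabsD _ _))// lerD2l.
Qed.

Lemma dual_sumE (R : realType) (k : scalar_kind) (V : normedModType (scalars R k))
  (I : Type) (r : seq I) (f : I -> dual V) x :
  (\sum_(i <- r) f i) x = \sum_(i <- r) f i x.
Proof. exact: (linear_sum (eval_dual x)). Qed.

Lemma dual_combE (R : realType) (k : scalar_kind) (V : normedModType (scalars R k))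
  (I : Type) (r : seq I) (a : I -> scalars R k) (f : I -> dual V) x :
  (\sum_(i <- r) a i *: f i) x = \sum_(i <- r) a i * f i x.
Proof. exact: (dual_sumE r (fun i => a i *: f i)). Qed.

Section dual_A.
Context {R : realType} {k : scalar_kind} (p : \bar R) (q theta : R).
Hypothesis (q1 : 1 <= q) (theta01 : 0 < theta < 1).
Hypothesis (p1 : (1 < p)%E) (qE : q = fine (hoelder_conjugate p)).
Local Notation K := (scalars R k).
Local Notation T := (tsirelson_conv k q1 theta01).
Implicit Types (x y z : T) (f : dual T).

Lemma head_expansion N z :
  maskT (fun j => j < N)%N z = \sum_(j < N) z j *: basisT q1 theta01 j.
Proof.
apply: tsirelson_ext => j; rewrite (tsirelson_sumE N (fun j => z j *: basisT q1 theta01 j)).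
rewrite maskTE; case: ltnP => jN.
  rewrite (bigD1 (Ordinal jN))//= big1 ?addr0.
    by rewrite -[RHS]/(z j * (j == j)%:R) eqxx mulr1.
  move=> i /eqP ij; rewrite -[LHS]/(z i * (j == i)%:R).
  by case: eqP => [ji|_]; rewrite ?mulr0//; case: ij; apply/val_inj.
rewrite big1// => i _; rewrite -[LHS]/(z i * (j == i)%:R).
by rewrite gtn_eqF ?mulr0// (leq_trans _ jN).
Qed.

(** A functional small at finitely many basis vectors is small on their span:
    this is how weak neighbourhoods control the beginning of a functional. *)
Lemma rabs_head_le f N (d : R) z : 0 <= d ->
  (forall j, (j < N)%N -> rabs (f (basisT q1 theta01 j)) <= d) ->
  rabs (f (maskT (fun j => j < N)%N z)) <= N%:R * d * rnorm z.
Proof.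
move=> d0 fd; rewrite head_expansion linear_sum /= (le_trans (ler_rabs_sum _ _))//.
apply: (@le_trans _ _ (\sum_(j < N) d * rnorm z)).
  apply: ler_sum => j _; rewrite linearZ rabsM mulrC.
  by rewrite ler_pM ?rabs_ge0// ?fd// rabs_coordT.
by rewrite sumr_const card_ord -mulrA mulr_natl.
Qed.

(** Player I keeps a threshold [N h] beyond which all the functionals played so
    far have norm at most [e], and requires the next one to have norm at most
    [e] before it.  On a vector [z], the [i]-th functional is then seen only
    through the restriction of [z] to the [i]-th interval between thresholds, up
    to [2 * e * rnorm z].  The thresholds start at [n] so that the [n] intervals
    are admissible, and increase strictly so that these are nonempty. *)
Lemma dual_A_game n : A_game (theta^-1 + 1) p n (dual T).
Proof.
have /andP[th0 th1] := theta01.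
(* The [n] errors [2 * e] add up to at most 1; [n.+1] covers [n = 0]. *)
pose e : R := (2 * n.+1%:R)^-1.
have e0 : 0 < e by rewrite invr_gt0 mulr_gt0 ?ltr0n.
have /choice[M HM] : forall f, exists N, forall x,
    (forall j, (j < N)%N -> x j = 0) -> rabs (f x) <= e * rnorm x.
  by move=> f; exact: shrinking.
pose N (h : seq (dual T)) := (n + \sum_(f <- h) (M f).+1)%N.
pose d h := e / (N h).+1%:R.
have d0 h : 0 < d h by rewrite divr_gt0 ?ltr0n.
exists (fun h => [set f : dual T | forall g, g \in
    [seq eval_dual (basisT q1 theta01 j) | j <- iota 0 (N h)] -> rabs (g f) < d h]).
  by move=> h; apply: open_nbhs_finite.
move=> x Hx a a1.
pose Ni i := N (take i x).
have NiS (i : 'I_n) : Ni i.+1 = (Ni i + (M (tnth x i)).+1)%N.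
  rewrite /Ni /N (take_nth 0) ?size_tuple// -(tnth_nth 0).
  by rewrite -cats1 big_cat big_seq1 /= addnA.
have NiS' i : (i < n)%N -> (Ni i < Ni i.+1)%N.
  by move=> ni; rewrite (NiS (Ordinal ni)) addnS ltnS leq_addr.
have Nile i j : (i <= j)%N -> (j <= n)%N -> (Ni i <= Ni j)%N.
  move=> ij; elim: j ij => [|j IH]; first by rewrite leqn0 => /eqP->.
  rewrite leq_eqVlt => /orP[/eqP->//|ij] jn.
  by apply: leq_trans (IH ij (ltnW jn)) (ltnW (NiS' j jn)).
pose s := [seq (Ni i, Ni i.+1) | i <- index_iota 0 n].
have ads : admissible s.
  rewrite /admissible; apply/andP; split.
    rewrite /s all_map; apply/allP => i; rewrite mem_index_iota => /andP[_ ni].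
    rewrite /= NiS'//= size_map size_iota subn0; apply: leqW; exact: leq_addr.
  rewrite /s pairwise_map.
  apply: (@sub_in_pairwise _ (fun i => i < n)%N ltn) => /=.
  - by move=> i j ni nj ij; apply: Nile => //; exact: ltnW.
  - by apply/allP => i; rewrite mem_index_iota.
  - by rewrite -(sorted_pairwise ltn_trans) iota_ltn_sorted.
have pE (i : 'I_n) z : rabs (tnth x i z) <=
    rnorm (maskT (fun j => Ni i <= j < Ni i.+1)%N z) + 2 * e * rnorm z.
  have [xU x1] := Hx i.
  have zE : z = maskT (fun j => j < Ni i)%N z +
     (maskT (fun j => Ni i <= j < Ni i.+1)%N z + maskT (fun j => Ni i.+1 <= j)%N z).
    apply: tsirelson_ext => j; rewrite !tsirelson_addE !maskTE.
    case: (ltnP j (Ni i)) => h1; case: (ltnP j (Ni i.+1)) => h2; rewrite ?addr0 ?add0r//.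
    by move: (leq_trans h2 (ltnW h1)); rewrite leqNgt NiS'.
  rewrite {1}zE !linearD (le_trans (ler_rabsD _ _))//.
  have h1 : rabs (tnth x i (maskT (fun j => j < Ni i)%N z)) <= e * rnorm z.
    apply: le_trans (rabs_head_le (d := d (take i x)) _ _ _) _.
    - exact: ltW.
    - move=> j jN; apply: ltW; apply: (xU (eval_dual (basisT q1 theta01 j))).
      by apply: map_f; rewrite mem_iota.
    rewrite ler_wpM2r ?rnorm_ge0// /d mulrA ler_pdivrMr ?ltr0n// mulrC ler_pM2l//.
    by rewrite ler_nat.
  have h3 : rabs (tnth x i (maskT (fun j => Ni i.+1 <= j)%N z)) <= e * rnorm z.
    have Hz := HM (tnth x i) (maskT (fun j => Ni i.+1 <= j)%N z).
    apply: (@le_trans _ _ (e * rnorm (maskT (fun j => Ni i.+1 <= j)%N z))); last first.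
      by apply: ler_wpM2l; [exact: ltW|exact: rnorm_maskT].
    apply: Hz => j jM; rewrite maskTE ifF//; apply/negbTE; rewrite -ltnNge NiS.
    exact: leq_trans jM (leq_trans (leqnSn _) (leq_addl _ _)).
  have h2 : rabs (tnth x i (maskT (fun j => Ni i <= j < Ni i.+1)%N z)) <=
      rnorm (maskT (fun j => Ni i <= j < Ni i.+1)%N z).
    by rewrite (le_trans (rabs_dual_le _ _))// ler_piMl ?rnorm_ge0// -rnorm_dual.
  apply: le_trans (lerD h1 (le_trans (ler_rabsD _ _) (lerD h2 h3))) _.
  by rewrite addrCA lerD2l -mulrA mulr_natl mulr2n.
rewrite rnorm_dual; apply: dual_norm_le => [|z].
  by rewrite addr_ge0// invr_ge0 ltW.
rewrite dual_combE (le_trans (ler_rabs_sum _ _))//.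
have z0 := rnorm_ge0 z.
apply: (@le_trans _ _ (\sum_(i < n) (rabs (a i) *
    rnorm (maskT (fun j => Ni i <= j < Ni i.+1)%N z) + 2 * e * rnorm z))).
  apply: ler_sum => i _; rewrite rabsM.
  apply: (le_trans (ler_wpM2l (rabs_ge0 _) (pE i z))).
  rewrite mulrDr lerD2l ler_piMl ?(lp_norm_coord i p1 a1)//.
  by rewrite !mulr_ge0// ltW.
rewrite big_split /= [leRHS]mulrDl; apply: lerD.
  apply: (lp_norm_pairing p1 qE _ _ _ a1) => [|i|].
  - by rewrite mulr_ge0// invr_ge0 ltW.
  - exact: rnorm_ge0.
  have := sum_maskT_admissible z ads.
  by rewrite /s big_map big_mkord.
rewrite sumr_const card_ord -[leLHS]mulr_natl mulrA ler_wpM2r//.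
by rewrite /e invfM mulVKf ?pnatr_eq0// ler_pdivrMr ?ltr0n// mul1r ler_nat.
Qed.

Lemma dual_has_A : has_A p (dual T).
Proof.
apply: (@le_lt_trans _ _ (theta^-1 + 1)%:E); last exact: ltry.
apply: ge_ereal_sup => _ [n _ <-]; apply: ereal_inf_lbound.
exists (theta^-1 + 1) => //; split; last exact: dual_A_game.
by have /andP[th0 _] := theta01; rewrite addr_gt0 ?invr_gt0.
Qed.

(** More coordinate functionals than vectors in a spanning family are linearly
    dependent, which evaluation at the basis vectors excludes. *)
Lemma dual_infinite_dimensional : infinite_dimensional (dual T).
Proof.
move=> [n [e He]].
have /choice[a Ha] : forall j : 'I_n.+1, exists a : 'I_n -> K,
  coordT q1 theta01 j = \sum_(i < n) a i *: e i by move=> j; exact: He.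
pose A : 'M[K]_(n.+1, n) := \matrix_(j, i) a j i.
have kA : kermx A != 0.
  rewrite kermx_eq0 -row_leq_rank -ltnNge ltnS; exact: rank_leq_col.
have /rowV0Pn[v /sub_kermxP vA /negP v0] := kA.
have v_dep : \sum_(j < n.+1) v 0 j *: coordT q1 theta01 j = 0.
  under eq_bigr do rewrite Ha scaler_sumr.
  rewrite exchange_big /= big1// => i _.
  under eq_bigr do rewrite scalerA.
  rewrite -scaler_suml.
  have -> : \sum_(j < n.+1) v 0 j * a j i = (v *m A) 0 i.
    by rewrite [RHS]mxE; apply: eq_bigr => j _; rewrite mxE.
  by rewrite vA mxE scale0r.
apply: v0; apply/eqP/rowP => j; rewrite mxE.
have := congr1 (fun f : dual T => f (basisT q1 theta01 j)) v_dep.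
rewrite dual_combE (bigD1 j)//= big1 ?addr0 => [|i ij].
  by rewrite eqxx mulr1.
rewrite (_ : (i == j :> nat) = false) ?mulr0//.
by apply/negbTE.
Qed.
End dual_A.

(** * Bounds for isomorphic embeddings *)
Lemma rnorm_eq0 (R : realType) (k : scalar_kind) (V : normedModType (scalars R k))
  (x : V) : rnorm x = 0 -> x = 0.
Proof. by move=> x0; apply/normr0_eq0; rewrite -ofR_rnorm x0 ofR0. Qed.

Section bounded_linear.
Context {R : realType} {k : scalar_kind} {V W : normedModType (scalars R k)}.
Local Notation K := (scalars R k).

Lemma linear_continuous_le (f : {linear V -> W}) : continuous f ->
  exists2 A : R, 0 <= A & forall x, rnorm (f x) <= A * rnorm x.
Proof.
move=> /linear_bounded_continuous/linear_boundedP[M0 [M0r fM]].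
pose M := `|M0| + 1.
have M0M : M0 < M by rewrite /M (le_lt_trans (real_ler_norm M0r))// ltrDl.
have M_ge0 : 0 <= M by rewrite addr_ge0.
exists (re M); first by rewrite -(@ler_ofR R k) reK// ofR0.
by move=> x; rewrite -(@ler_ofR R k) ofRM reK// !ofR_rnorm; exact: fM.
Qed.

Lemma inverse_continuous_le (f : {linear V -> W}) (S : W -> V) (Z : set W) :
  range f = Z -> cancel f S -> {within Z, continuous S} ->
  exists2 B : R, 0 <= B & forall x, rnorm x <= B * rnorm (f x).
Proof.
move=> fZ fS /subspace_continuousP Sc.
have Z0 : Z 0 by rewrite -fZ; exists 0 => //; rewrite linear0.
have S0 : S 0 = 0 by rewrite -(linear0 f) fS.
have : S @ within Z (nbhs 0) --> S 0 := Sc 0 Z0.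
rewrite S0 => /cvgrPdist_lt/(_ 1 ltr01); rewrite near_withinE => /nbhs_ballP[d /= d0 dZ].
have rd0 : 0 < re d by rewrite -(@ltr_ofR R k) reK ?ltW// ofR0.
exists (2 / re d); first by rewrite divr_ge0// ltW.
move=> x; have [fx0|fx0] := eqVneq (rnorm (f x)) 0.
  have x0 : x = 0 by rewrite -(fS x) (rnorm_eq0 fx0) S0.
  by rewrite x0 linear0 !rnorm0 mulr0.
have fxp : 0 < rnorm (f x) by rewrite lt_neqAle eq_sym fx0 rnorm_ge0.
pose a : R := re d / 2 / rnorm (f x).
have a0 : 0 < a by rewrite !divr_gt0.
have : rnorm (ofR a *: x) < 1.
  rewrite -(@ltr_ofR R k) ofR_rnorm ofR1.
  have := dZ (f (ofR a *: x)); rewrite /= fS sub0r normrN; apply.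
    rewrite -ball_normE /ball_/= sub0r normrN -ofR_rnorm -(reK (ltW d0)) ltr_ofR.
    rewrite linearZ rnormZ rabs_ofR ?(ltW a0)// divfK ?gt_eqF//.
    by rewrite ltr_pdivrMr// ltr_pMr// ltr1n.
  by rewrite -fZ; exists (ofR a *: x).
rewrite rnormZ rabs_ofR ?(ltW a0)// mulrC -ltr_pdivlMr// => /ltW/le_trans; apply.
by rewrite mul1r /a !invf_div mulrC.
Qed.
End bounded_linear.

(** * Repeated averages and the non-embedding *)
Lemma spread_le (R : realType) (k : scalar_kind) (t : R) m (M M' : R) (y : nat -> (scalars R k)^o) :
  M <= M' -> spread t m M y -> spread t m M' y.
Proof. by move=> MM ys zs zm zy; exact: le_trans (ys zs zm zy) MM. Qed.

Lemma exprn_powR (R : realType) (u r : R) n : 0 <= u -> (u ^+ n) `^ r = (u `^ r) ^+ n.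
Proof.
move=> u0; elim: n => [|n IH]; first by rewrite !expr0 powR1.
by rewrite !exprS powRM ?exprn_ge0// IH.
Qed.

Section nonembedding.
Context {R : realType} {k : scalar_kind} (p : \bar R) (q theta : R).
Hypothesis (q1 : 1 <= q) (theta01 : 0 < theta < 1).
Hypothesis (p1 : (1 < p)%E) (qE : q = fine (hoelder_conjugate p)).
Local Notation K := (scalars R k).
Local Notation T := (tsirelson_conv k q1 theta01).
Local Notation t := (theta `^ q).
Variables (U : normedModType K) (C : R).
Hypothesis (C1 : 1 <= C) (UN : forall n, N_game C p n U).
Variables (Y : closed_subspace U) (F : {linear dual T -> quotient_space Y}) (A : R).
Hypothesis (A0 : 0 <= A) (FA : forall f, rnorm (F f) <= A * rnorm f).
Implicit Types (x y z : T) (f : dual T) (w : U).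

Let q0 : 0 < q. Proof. exact: lt_le_trans q1. Qed.
Let t01 : 0 < t < 1. Proof. exact: powR_theta01. Qed.
(* The scaling that makes differences of two lifts lie in the unit ball. *)
Let c : R := (2 * (A + 1))^-1.

(** What [i] levels of games produce: a move [w] in U, of norm at most 1 and as
    weakly small as prescribed; the functional [f] on T_{q,theta} that it lifts;
    and a vector [x] testing [f], both living on the coordinates from [N] to
    [L - 1].  The normalisation by [C] at each level shows in the value of [f] at
    [x], while the norm of [x] is governed by its spread, where [m] pieces are
    allowed for the needs of the next level. *)
Definition block_play (i : nat) (G : seq (dual U)) (e : R) (N m : nat)
    (d : U * dual T * T * nat) : Prop :=
  let: (w, f, x, L) := d in
  [/\ (N <= L)%N, quotient_map Y w = F f, rnorm w <= 1,
      forall g, g \in G -> rabs (g w) < e &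
  [/\ forall z, (forall j, (N <= j < L)%N -> z j = 0) -> f z = 0,
      f x = ofR (c * C^-1 ^+ i),
      forall j, ~~ (N <= j < L)%N -> x j = 0,
      forall L', \sum_(j < L') rabs (x j) `^ q <= 1 &
      spread t m ((2 * t) ^+ i) (power_seq q x)]].

Lemma lift_basis : exists v : nat -> U, forall j,
  quotient_map Y (v j) = F (ofR c *: coordT q1 theta01 j) /\ rnorm (v j) <= 2^-1.
Proof.
have A1 : 0 < A + 1 by rewrite ltr_wpDl.
have c0 : 0 < c by rewrite invr_gt0 mulr_gt0.
suff /choice[v Hv] : forall j, exists u, quotient_map Y u =
    F (ofR c *: coordT q1 theta01 j) /\ rnorm u <= 2^-1 by exists v.
move=> j; have [u uq un] := quotient_norm_lt (F (coordT q1 theta01 j)) ltr01.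
exists (ofR c *: u); split.
  by rewrite linearZ /= uq linearZ.
rewrite rnormZ rabs_ofR ?(ltW c0)//.
apply: (@le_trans _ _ (c * (A + 1))); last first.
  by rewrite /c invfM -mulrA mulVf ?mulr1// gt_eqF.
rewrite ler_pM2l// ltW// (lt_le_trans un)// lerD2r -rnorm_quotient.
by rewrite (le_trans (FA _))// ler_piMr// rnorm_coordT.
Qed.

Lemma block_play0 G e N m : 0 < e -> exists d, block_play 0 G e N m d.
Proof.
move=> e0; have [v Hv] := lift_basis.
have v1 j : rnorm (v j) <= 1 by case: (Hv j) => _ /le_trans; apply; lra.
have [i [j [Ni ij Gij]]] := weak_close_pair G N e0 v1.
pose f : dual T := ofR c *: coordT q1 theta01 i - ofR c *: coordT q1 theta01 j.
have fE z : f z = ofR c * z i - ofR c * z j by [].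
pose x : T := basisT q1 theta01 i.
have xE L' : \sum_(j' < L') rabs (x j') `^ q <= 1.
  have b0 j' : j' != i -> rabs (x j') `^ q = 0.
    by move=> /negbTE ji; rewrite /x /= ji rabs0 powR0// gt_eqF.
  have [iL|Li] := ltnP i L'; last first.
    by rewrite big1// => j' _; apply: b0; rewrite ltn_eqF// (leq_trans _ Li).
  rewrite (bigD1 (Ordinal iL))//= big1 ?addr0 => [|j' ji].
    by rewrite eqxx -[1%:R]ofR1 rabs_ofR// powR1.
  by apply: b0; apply: contra ji => /eqP h; apply/eqP/val_inj.
exists (v i - v j, f, x, j.+1); split=> //.
- by rewrite (leq_trans Ni)// ltnW// ltnW// ltnS.
- rewrite linearB /=; case: (Hv i) => -> _; case: (Hv j) => -> _.
  by rewrite -linearB.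
- rewrite (le_trans (ler_rnormD _ _))// -scaleN1r rnormZ.
  rewrite rabsN -[1]ofR1 rabs_ofR// mul1r.
  by case: (Hv i) => _ h1; case: (Hv j) => _ h2; lra.
split=> //.
- move=> z z0; rewrite fE !z0 ?mulr0 ?subr0//.
    by rewrite (leq_trans Ni (ltnW ij)) ltnSn.
  by rewrite Ni ltnS ltnW.
- rewrite fE /= eqxx gtn_eqF// mulr0 subr0 mulr1 expr0 mulr1//.
- move=> j' j'N /=; rewrite (_ : (j' == i) = false)//.
  apply: contraNF j'N => /eqP->; by rewrite Ni ltnS ltnW.
- have xi j' : (i < j')%N -> power_seq q x j' = 0.
    by move=> ij'; rewrite /power_seq /= gtn_eqF// rabs0 powR0 ?ofR0// gt_eqF.
  rewrite expr0; apply: spread_le (@spread_l1 _ _ t t01 m i.+1 (power_seq q x) xi).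
  by under eq_bigr do rewrite rabs_power_seq.
Qed.

(** Player II plays a game of length [n], answering each neighbourhood by a play of
    level [i] that begins where the previous one ended, at [L l], and whose spread is
    bounded for [m * L l] pieces, as the averaging step requires.  The outcome is
    divided by [C * n^(1/p)], and the sum of the test vectors by [n^(1/q)]. *)
Lemma block_playS i : (forall G e N m, 0 < e -> exists d, block_play i G e N m d) ->
  forall G e N m, 0 < e -> exists d, block_play i.+1 G e N m d.
Proof.
move=> IH G e N m e0; have /andP[t0 t1] := t01.
pose M := (2 * t) ^+ i.
have M0 : 0 < M by rewrite exprn_gt0// mulr_gt0.
have tM0 : 0 < t * M by rewrite mulr_gt0.
(* Large enough for the errors [2 * m + t * m] of the averaging step to be
   absorbed in a second [n * (t * M)]. *)
pose n := (Num.truncn (3 * m%:R / (t * M))).+1.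
have nm : 3 * m%:R <= n%:R * (t * M).
  rewrite -ler_pdivrMr// ltW//.
  by have /truncn_itv/andP[] : 0 <= 3 * m%:R / (t * M) by rewrite divr_ge0 ?mulr_ge0// ltW.
have n0 : 0 < n%:R :> R by rewrite ltr0n.
have [sigma sopen swin] := UN n.
pose Lof (h : seq (U * dual T * T * nat)) := last N [seq d.2 | d <- h].
pose ws (h : seq (U * dual T * T * nat)) := [seq d.1.1.1 | d <- h].
have en0 : 0 < e / n.+1%:R by rewrite divr_gt0// ltr0n.
have /choice[nxt Hnxt] : forall h, exists d,
    block_play i G (e / n.+1%:R) (Lof h) (m * Lof h)%N d /\ sigma (ws h) d.1.1.1.
  move=> h; have [H [e' [e'0 He']]] := weak_nbhs_finite (sopen (ws h)).
  have [|[[[w f] x] L] [NL wf w1 wG [fz fx x0 x1 xs]]] :=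
      IH (G ++ H) (Num.min (e / n.+1%:R) e') (Lof h) (m * Lof h)%N.
    by rewrite lt_min en0.
  exists (w, f, x, L); split.
    split=> // g gG; have := wG g; rewrite mem_cat gG => /(_ isT).
    by rewrite lt_min => /andP[].
  apply: He' => g gH; have := wG g; rewrite mem_cat gH orbT => /(_ isT).
  by rewrite lt_min => /andP[].
pose hs l := iter l (fun h => rcons h (nxt h)) [::].
pose d l := nxt (hs l).
have hsS l : hs l.+1 = rcons (hs l) (d l) by [].
have hsE l : hs l = mkseq d l.
  by elim: l => // l IHl; rewrite hsS IHl /mkseq -addn1 iotaD map_cat cats1.
pose w l := (d l).1.1.1; pose f l := (d l).1.1.2; pose x l := (d l).1.2.
pose L l := Lof (hs l).
have LS l : L l.+1 = (d l).2 by rewrite /L hsS /Lof map_rcons last_rcons.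
have L0 : L 0%N = N by [].
have dE l : d l = (w l, f l, x l, L l.+1).
  by rewrite LS /w /f /x; case: (d l) => [[[? ?] ?] ?].
have Hd l : block_play i G (e / n.+1%:R) (L l) (m * L l)%N (w l, f l, x l, L l.+1) /\
    sigma (ws (hs l)) (w l).
  by rewrite -dE; exact: Hnxt.
have Lnd : {homo L : l l' / (l <= l')%N}.
  by apply: homo_leq => // [a b b'|l]; [exact: leq_trans|case: (Hd l) => -[]].
have xsupp l j : ~~ (L l <= j < L l.+1)%N -> x l j = 0.
  by case: (Hd l) => -[_ _ _ _ [_ _ + _ _] _]; apply.
have fsupp l z : (forall j, (L l <= j < L l.+1)%N -> z j = 0) -> f l z = 0.
  by case: (Hd l) => -[_ _ _ _ [+ _ _ _ _] _]; apply.
have fx l : f l (x l) = ofR (c * C^-1 ^+ i).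
  by case: (Hd l) => -[_ _ _ _ [_ -> _ _ _] _].
have wn : rnorm (\sum_(l < n) w l) <= C * proot p n.
  have szt : size (mkseq w n) == n by rewrite size_mkseq.
  have := swin (Tuple szt); rewrite (eq_bigr (fun l : 'I_n => w l)); last first.
    by move=> l _; rewrite (tnth_nth 0) /= nth_mkseq.
  apply=> l; rewrite (tnth_nth 0) /= nth_mkseq//.
  have -> : take l (mkseq w n) = ws (hs l).
    rewrite hsE /mkseq -map_take take_iota /ws -map_comp (minn_idPl _)//.
    exact: ltnW.
  by case: (Hd l) => -[_ _ ? _ _] ?; split.
have P1 : 1 <= proot p n.
  rewrite /proot; case: (p) p1 => [r r1| |//] //=.
  have r0 : 0 < r by move: r1; rewrite lte_fin => /(lt_trans ltr01).
  by rewrite -[leLHS](powRr0 n%:R) ler_powR ?ler1n// invr_ge0 ltW.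
have Pn := proot_conjugate n p1 qE.
set P := proot p n in wn P1 Pn.
have P0 : 0 < P by exact: lt_le_trans P1.
have C0 : 0 < C by exact: lt_le_trans C1.
pose a := (C * P)^-1; pose b := (n%:R `^ q^-1)^-1.
have a0 : 0 < a by rewrite invr_gt0 mulr_gt0.
have a1 : a <= 1 by rewrite invf_le1 ?mulr_gt0// -[1]mulr1 ler_pM.
have nq0 : 0 < n%:R `^ q^-1 by rewrite powR_gt0.
have b0 : 0 < b by rewrite invr_gt0.
have abn : a * b * n%:R = C^-1.
  by rewrite -[X in _ * X = _]Pn /a /b; field; rewrite !gt_eqF.
have bq : b `^ q = n%:R^-1.
  have nq : (n%:R `^ q^-1) `^ q = n%:R by rewrite -powRrM mulVf ?gt_eqF// powRr1// ltW.
  apply: (mulIf (lt0r_neq0 n0)); rewrite mulVf ?gt_eqF//.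
  rewrite -[X in _ * X]nq -powRM ?(ltW nq0) ?(ltW b0)//.
  by rewrite mulVf ?gt_eqF// powR1.
pose X : T := ofR b *: \sum_(l < n) x l.
have Xj j : X j = ofR b * (\sum_(l < n) x l) j by [].
have Xq j : rabs (X j) `^ q = n%:R^-1 * rabs (power_seq q (\sum_(l < n) x l) j).
  by rewrite Xj rabsM rabs_ofR ?(ltW b0)// powRM ?rabs_ge0 ?(ltW b0)// bq rabs_power_seq.
have Xs j := power_block_sum j Lnd (fun l j _ => @xsupp l j) (n := n).
exists (ofR a *: \sum_(l < n) w l, ofR a *: \sum_(l < n) f l, X, L n).
split=> //.
- by rewrite -L0; exact: Lnd.
- rewrite !linearZ /= !linear_sum; apply: eq_bigr => l _.
  have wf : quotient_map Y (w l) = F (f l) by case: (Hd l) => -[].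
  exact: (congr1 (fun u => ofR a *: u) wf).
- rewrite rnormZ rabs_ofR ?(ltW a0)// /a mulrC ler_pdivrMr ?mulr_gt0// mul1r//.
- move=> g gG; rewrite linearZ rabsM rabs_ofR ?(ltW a0)// linear_sum /=.
  apply: (@le_lt_trans _ _ (\sum_(l < n) rabs (g (w l)))).
    apply: (le_trans (ler_wpM2l (ltW a0) (ler_rabs_sum _ _))).
    by rewrite ler_piMl// sumr_ge0// => l _; exact: rabs_ge0.
  apply: (@le_lt_trans _ _ (\sum_(l < n) e / n.+1%:R)).
    by apply: ler_sum => l _; apply: ltW; case: (Hd l) => -[_ _ _ + _] _; exact.
  rewrite sumr_const card_ord -[ltLHS]mulr_natl mulrA ltr_pdivrMr ?ltr0n// mulrC.
  by rewrite ltr_pM2l// ltr_nat.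
split.
- move=> z z0; rewrite -[LHS]/(ofR a * (\sum_(l < n) f l) z) dual_sumE big1 ?mulr0// => l _.
  apply: fsupp => j /andP[lj jl]; apply: z0.
  by rewrite -L0 (leq_trans _ lj) ?Lnd// (leq_trans jl)// Lnd.
- rewrite -[LHS]/(ofR a * (\sum_(l < n) f l) X) dual_sumE.
  rewrite (eq_bigr (fun l => ofR (b * (c * C^-1 ^+ i)))); last first.
    move=> l _; rewrite /X linearZ linear_sum (bigD1 l)//= big1 ?addr0.
      by rewrite fx [RHS]ofRM.
    move=> l' ll'; apply: fsupp => j jl; apply: xsupp; apply/negP => jl'.
    case/eqP: ll'; apply/val_inj; exact: (block_uniq Lnd jl' jl).
  rewrite -ofR_sum sumr_const card_ord -ofRM; congr ofR.
  by rewrite exprS -abn -mulr_natr; ring.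
- move=> j; rewrite negb_and -!ltnNge ltnS => jN; rewrite Xj tsirelson_sumE big1 ?mulr0// => l _.
  apply: xsupp; rewrite negb_and -!ltnNge ltnS; case/orP: jN => jN.
    by rewrite (leq_trans jN)// -L0 Lnd.
  by rewrite (leq_trans _ jN) ?orbT// Lnd.
- move=> L'; under eq_bigr do rewrite Xq rabs_power_seq Xs.
  rewrite -mulr_sumr mulrC ler_pdivrMr// mul1r exchange_big /=.
  rewrite -[X in _ <= X%:R]card_ord -sumr_const; apply: ler_sum => l _.
  under eq_bigr do rewrite rabs_power_seq.
  by case: (Hd l) => -[_ _ _ _ [_ _ _ + _] _]; apply.
- pose Z := power_seq q (\sum_(l < n) x l).
  have ps0 l j : ~~ (L l <= j < L l.+1)%N -> power_seq q (x l) j = 0.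
    by move=> /xsupp xj; rewrite /power_seq xj rabs0 powR0 ?ofR0// gt_eqF.
  have Zs : spread t m (2 * m%:R + t * (m%:R + n%:R * M)) Z.
    apply: (@spread_blocks _ _ t t01 n L (fun l => power_seq q (x l)) Lnd) => [l j _|l _|l _|j].
    - exact: ps0.
    - under eq_bigr do rewrite rabs_power_seq.
      by case: (Hd l) => -[_ _ _ _ [_ _ _ + _] _]; apply.
    - by case: (Hd l) => -[_ _ _ _ [_ _ _ _ +] _]; apply.
    - by rewrite rabs_power_seq Xs.
  have fZ : finitely_supported Z.
    exists (L n) => j nj; rewrite /Z /power_seq tsirelson_sumE.
    rewrite big1 ?rabs0 ?powR0 ?ofR0 ?gt_eqF// => l _.
    by rewrite xsupp// negb_and -!ltnNge ltnS (leq_trans _ nj) ?orbT// Lnd.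
  apply: spread_le (spread_scale t01 (c := n%:R^-1) fZ _ _ Zs); last first.
  + by move=> j; rewrite rabs_power_seq Xq.
  + by rewrite invr_gt0.
  rewrite exprS mulrC ler_pdivrMr// -/M.
  have : t * m%:R <= m%:R by rewrite ler_piMl// ltW.
  by move: nm; nra.
Qed.

Lemma block_play_exists i G e N m : 0 < e -> exists d, block_play i G e N m d.
Proof.
elim: i G e N m => [|i IH] G e N m; first exact: block_play0.
exact: block_playS.
Qed.

(** Evaluating [f] at [x] gives [c * C^(-i) <= B * (2 * theta)^i], that is,
    [c * 2^i <= B], for every [i]. *)
Lemma not_bounded_below (B : R) : 0 <= B -> theta = (4 * C)^-1 ->
  ~ forall f, rnorm f <= B * rnorm (F f).
Proof.
move=> B0 thE FB; have /andP[th0 th1] := theta01; have /andP[t0 t1] := t01.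
have C0 : 0 < C by exact: lt_le_trans C1.
have c0 : 0 < c by rewrite invr_gt0 mulr_gt0// ltr_wpDl.
have cB i : c * 2 ^+ i <= B.
  have [[[[w f] x] L] [_ wf w1 _ [_ fx _ x1 xs]]] := block_play_exists i [::] 0 1 ltr01.
  have nx : rnorm x <= (2 * theta) ^+ i.
    apply: rnormT_le; first by rewrite exprn_ge0// mulr_ge0// ltW.
    have := xs [:: power_seq q x] isT; rewrite big_seq1 => /(_ _)/le_trans; apply.
      by move=> j; rewrite big_seq1.
    have th2 : 0 <= 2 * theta by rewrite mulr_ge0// ltW.
    rewrite exprn_powR//.
    rewrite lerXn2r ?nnegrE ?mulr_ge0 ?powR_ge0// powRM ?(ltW th0)//.
    by rewrite ler_wpM2r ?powR_ge0// le1r_powR// ler1n.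
  have : c * C^-1 ^+ i <= B * (2 * theta) ^+ i.
    have cC0 : 0 <= c * C^-1 ^+ i.
      by apply: mulr_ge0; [exact: ltW|rewrite exprn_ge0// invr_ge0 ltW].
    rewrite -(@rabs_ofR R k _ cC0) -fx (le_trans (rabs_dual_le _ _))//.
    rewrite ler_pM ?dual_norm_ge0 ?rnorm_ge0// -rnorm_dual (le_trans (FB _))//.
    by rewrite ler_piMr// -wf rnorm_quotient (le_trans (quotient_norm_le _ _)).
  have -> : 2 * theta = C^-1 / 2.
    by rewrite thE; field; rewrite gt_eqF.
  have C20 : 0 < C ^+ i by exact: exprn_gt0.
  rewrite exprMn mulrCA exprVn mulrC ler_pM2l ?invr_gt0// exprVn.
  by rewrite ler_pdivlMr// exprn_gt0.
have : c * (Num.truncn (B / c)).+1%:R <= B.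
  apply: le_trans (cB (Num.truncn (B / c)).+1); rewrite ler_pM2l// -natrX ler_nat.
  by rewrite ltnW// ltn_expl.
rewrite mulrC -ler_pdivlMr// leNgt => /negP; apply.
by have /truncn_itv/andP[] : 0 <= B / c by rewrite divr_ge0// ltW.
Qed.
End nonembedding.

(** * Conclusion *)
Lemma N_game_le (R : realType) (k : scalar_kind) (p : \bar R) n
    (U : normedModType (scalars R k)) (c c' : R) : c <= c' ->
  N_game c p n U -> N_game c' p n U.
Proof.
move=> cc' [sigma sopen swin]; exists sigma => // x /swin /le_trans; apply.
rewrite ler_wpM2r// /proot; case: p {swin} => [r||] //; exact: powR_ge0.
Qed.

Lemma has_N_uniform (R : realType) (k : scalar_kind) (p : \bar R)
    (U : normedModType (scalars R k)) : has_N p U ->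
  exists2 C : R, 1 <= C & forall n, N_game C p n U.
Proof.
rewrite /has_N => UN.
have [M UM] : exists M : R, forall n, (N_const p n U < M%:E)%E.
  move: UN; set s := ereal_sup _ => UN.
  have sn n : (N_const p n U <= s)%E by apply: ereal_sup_ubound; exists n.
  case: s UN sn => [r _|//|_] sn; last by exists 0 => n; rewrite (le_lt_trans (sn n))// ltNyr.
  by exists (r + 1) => n; rewrite (le_lt_trans (sn n))// lte_fin ltrDl.
exists (Num.max 1 M); first by rewrite le_max lexx.
move=> n; have [_ [c [_ Uc] <-]] := ereal_inf_lt (UM n).
rewrite lte_fin => cM; apply: N_game_le Uc.
by rewrite le_max (ltW cM) orbT.
Qed.

Unset Implicit Arguments.

Theorem theorem3 (R : realType) (k : scalar_kind) (p : \bar R) (hp : (1 < p)%E)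
    (U : completeNormedModType (scalars R k))
    (U_infinite : infinite_dimensional U) (U_N : has_N p U) :
  (exists X : completeNormedModType (scalars R k),
     [/\ infinite_dimensional X, has_A p X &
         ~ isomorphic_to_subspace_of_quotient X U]) /\
  (exists (theta : R) (theta01 : 0 < theta < 1),
     let Tdual : completeNormedModType (scalars R k) :=
       dual (tsirelson_conv k (fine_hoelder_conjugate_ge1 hp) theta01) in
     [/\ infinite_dimensional Tdual, has_A p Tdual &
         ~ isomorphic_to_subspace_of_quotient Tdual U]).
Proof.
suff [theta [theta01 H]] : exists (theta : R) (theta01 : 0 < theta < 1),
     let Tdual : completeNormedModType (scalars R k) :=
       dual (tsirelson_conv k (fine_hoelder_conjugate_ge1 hp) theta01) in
     [/\ infinite_dimensional Tdual, has_A p Tdual &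
         ~ isomorphic_to_subspace_of_quotient Tdual U].
  by split; [eexists; exact: H|exists theta, theta01].
have [C C1 UC] := has_N_uniform U_N.
have C0 : 0 < C by exact: lt_le_trans C1.
have theta01 : 0 < (4 * C)^-1 < 1.
  rewrite invr_gt0 mulr_gt0//= invf_lt1 ?mulr_gt0//.
  by rewrite (le_lt_trans C1)// ltr_pMl// ltr1n.
exists (4 * C)^-1, theta01 => /=; split.
- exact: dual_infinite_dimensional.
- exact: (dual_has_A _ theta01 hp erefl).
- move=> [Y [Z [F [S [Fc FZ FS Sc]]]]].
  have [A A0 FA] := linear_continuous_le Fc.
  have [B B0 FB] := inverse_continuous_le FZ FS Sc.
  exact: (not_bounded_below hp erefl C1 UC A0 FA B0 erefl FB).
Qed.
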